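(* Let $n\ge 3$. There exists a constant $C(n)>0$, depending only on $n$, such that for every convex $n$-gon $P\subset\mathbb{R}^2$, $$\sigma_s^2(P)+\sigma_r^2(P)\le C(n)\,\delta(P).$$
   Context: A convex $n$-gon $P\subset\mathbb{R}^2$ is a closed polygon that is the boundary of a convex region, with vertices $A_1,\ldots,A_n$ listed in order along that boundary, indices read modulo $n$, and $A_i=A_j$ if and only if $i\equiv j\pmod n$. Let $O=\frac1n\sum_{i=1}^n A_i$ be the center of mass of the vertices, $l_i=|A_iA_{i+1}|$ the side lengths, $r_i=|OA_i|$ the radii, $L(P)=\sum_{i=1}^n l_i$ the perimeter, $S(P)=\sum_{i=1}^n l_i^2$, and $F(P)$ the area of $P$. The polygonal isoperimetric deficit is $\delta(P)=L^2(P)-4n\tan\frac{\pi}{n}\,F(P)$. The variances of the side lengths and of the radii are $$\sigma_s^2(P)=\frac1n S(P)-\frac1{n^2}L^2(P),\qquad \sigma_r^2(P)=\frac1n\sum_{i=1}^n r_i^2-\frac1{n^2}\Big(\sum_{i=1}^n r_i\Big)^2.$$ *)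

(* Defs.v *)
From mathcomp Require Import all_boot all_order all_algebra.
From mathcomp Require Import all_classical all_reals all_analysis.

Set Implicit Arguments.
Unset Strict Implicit.
Unset Printing Implicit Defensive.

Import Order.TTheory GRing.Theory Num.Theory.
Import numFieldNormedType.Exports.

Local Open Scope classical_set_scope.
Local Open Scope ring_scope.

(* The canonical norm of R * R is the max norm, hence an explicit distance. *)
Definition dist2 (R : realType) (p q : R * R) : R :=
  Num.sqrt ((p.1 - q.1) ^+ 2 + (p.2 - q.2) ^+ 2).

Definition area (R : realType) (K : set (R * R)) : R :=
  fine ((@lebesgue_measure R \x @lebesgue_measure R)%E K).

(* ordS is the cyclic successor of 'I_n, so indices are read modulo n. *)
Definition side_point (R : realType) (n : nat) (A : 'I_n -> R * R)
    (i : 'I_n) (t : R) : R * R :=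
  (1 - t) *: A i + t *: A (ordS i).

Definition closed_polygon (R : realType) (n : nat) (A : 'I_n -> R * R) :
    set (R * R) :=
  [set p | exists (i : 'I_n) (t : R), 0 <= t <= 1 /\ p = side_point A i t].

(* The closed path A_1 A_2 ... A_n A_1 visits no point twice.  With s = t = 0
   this says that the vertices are pairwise distinct; together with
   ngon_boundary below, it says that they are listed in order along the
   boundary (without it the path could backtrack along an edge). *)
Definition simple_path (R : realType) (n : nat) (A : 'I_n -> R * R) : Prop :=
  forall (i j : 'I_n) (s t : R), 0 <= s < 1 -> 0 <= t < 1 ->
    side_point A i s = side_point A j t -> i = j /\ s = t.

(* Straight angles at vertices are not excluded. *)
Record convex_ngon (R : realType) (n : nat) := ConvexNgon {
  vertex : 'I_n -> R * R ;
  region : set (R * R) ;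
  region_compact : compact region ;
  region_convex : convex_set region ;
  region_interior : region° !=set0 ;
  ngon_simple : simple_path vertex ;
  ngon_boundary : closed_polygon vertex = closure region `\` region° }.

Section Functionals.
Variables (R : realType) (n : nat) (P : convex_ngon R n).

Definition center : R * R := n%:R^-1 *: \sum_(i < n) vertex P i.

Definition side_length (i : 'I_n) : R := dist2 (vertex P i) (vertex P (ordS i)).

Definition radius (i : 'I_n) : R := dist2 center (vertex P i).

Definition perimeter : R := \sum_(i < n) side_length i.

Definition sum_sq_sides : R := \sum_(i < n) side_length i ^+ 2.

Definition ngon_area : R := area (region P).

Definition deficit : R :=
  perimeter ^+ 2 - 4 * n%:R * tan (pi / n%:R) * ngon_area.

Definition var_sides : R :=
  n%:R^-1 * sum_sq_sides - (n%:R ^+ 2)^-1 * perimeter ^+ 2.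

Definition var_radii : R :=
  n%:R^-1 * (\sum_(i < n) radius i ^+ 2)
  - (n%:R ^+ 2)^-1 * (\sum_(i < n) radius i) ^+ 2.

End Functionals.

(* Main.v *)
(* For a closed n-path A with length L, energy S (the sum of the squared sides)
   and signed area F, put t = tan (pi / n).  In the coordinates centered at the
   centroid, the discrete Wirtinger inequality gives S - 4 t F >= Q / 2, where Q
   measures how far each vertex is from the rotation by 2 pi / n of its
   predecessor; Wirtinger applied to the radii then bounds the variance of the
   radii by a multiple of S - 4 t F.  As n (S - 4 t F) is the deficit
   L^2 - 4 n t F plus n S - L^2, it remains to bound n S - L^2, that is, the
   variance of the sides, by the deficit.

   For this, minimize L^2 - 4 n t F - c (n S - L^2) among paths of length 1.
   Moving a vertex parallel to the line through its neighbours until it is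
   equidistant from them preserves F and lowers L, by an amount that dominates
   the change of c n S as long as c > 0 is small and the two edges at the vertex
   span a triangle of area bounded below.  So a minimizer with a negative value
   for which this holds at all vertices is equilateral; then n S = L^2 and the
   form equals n (S - 4 t F) >= 0, a contradiction.  The other paths have, by
   compactness, deficit bounded away from 0, because the deficit is nonnegative
   (same argument, with c < 0 tending to 0) and vanishes only on regular n-gons.

   Finally, the area of a convex n-gon is at most |F|: an interior point p sees
   the boundary exactly once in each direction, so the triangles p A_i A_(i+1)
   cover the region and have the same orientation. *)
Require Import Defs.
From mathcomp Require Import all_boot all_order all_algebra.
From mathcomp Require Import all_classical all_reals all_analysis.
From mathcomp Require Import measurable_realfun.
From mathcomp Require Import zify ring lra.

Set Implicit Arguments.
Unset Strict Implicit.
Unset Printing Implicit Defensive.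

Import Order.TTheory GRing.Theory Num.Theory.
Import numFieldNormedType.Exports.

Local Open Scope classical_set_scope.
Local Open Scope ring_scope.

(** * Discrete Wirtinger inequality *)

Lemma sum_ordS (V : nmodType) (n : nat) (f : 'I_n -> V) :
  \sum_(i < n) f (ordS i) = \sum_(i < n) f i.
Proof. by rewrite [RHS](reindex_inj (@ordS_inj n)). Qed.

Lemma pi2_mulrn (R : realType) (k : nat) : pi *+ 2 *+ k = 2 * pi * k%:R :> R.
Proof. by rewrite -mulrnA -[LHS]mulr_natr natrM; ring. Qed.

(** Multiplied by [2 * sin (b / 2)], which is positive because [b / 2 = pi * m / n] lies strictly
    between 0 and [pi], the sum telescopes to a difference of sines at points [m] full periods
    apart. *)
Lemma sum_cos_eq0 (R : realType) (n m : nat) :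
  (0 < m < n)%N -> \sum_(k < n) cos (k%:R * (2 * pi / n%:R * m%:R)) = 0 :> R.
Proof.
move=> /andP[m0 mn]; set b := 2 * pi / n%:R * m%:R.
have n0 : n%:R != 0 :> R by rewrite pnatr_eq0; apply/eqP => n0; rewrite n0 in mn.
have nR : 0 < n%:R :> R by rewrite lt0r n0 ler0n.
have sb : 0 < sin (b / 2).
  apply: sin_gt0_pi; rewrite /b.
  have -> : 2 * pi / n%:R * m%:R / 2 = pi * (m%:R / n%:R) :> R by field.
  rewrite mulr_gt0 ?pi_gt0 ?divr_gt0 ?ltr0n ?(leq_ltn_trans _ mn)//=.
  by rewrite gtr_pMr ?pi_gt0// ltr_pdivrMr// mul1r ltr_nat.
suff H : 2 * sin (b / 2) * \sum_(k < n) cos (k%:R * b) = 0.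
  by move/eqP: H; rewrite mulf_eq0 mulf_eq0 pnatr_eq0 /= (gt_eqF sb) => /eqP.
rewrite mulr_sumr.
rewrite (eq_bigr (fun k : 'I_n =>
  sin ((k.+1)%:R * b - b / 2) - sin (k%:R * b - b / 2))); last first.
  move=> k _; have -> : (k.+1)%:R * b - b / 2 = k%:R * b + b / 2.
    by rewrite -natr1; field.
  by rewrite sinD sinB; ring.
rewrite -(big_mkord xpredT (fun k =>
  sin ((k.+1)%:R * b - b / 2) - sin (k%:R * b - b / 2))).
rewrite (telescope_sumr (fun k => sin (k%:R * b - b / 2)))//.
have -> : n%:R * b - b / 2 = - (b / 2) + pi *+ 2 *+ m.
  by rewrite /b pi2_mulrn; field.
by rewrite (periodicn (@sinD2pi R)) mul0r add0r subrr.
Qed.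

Section Fourier.
Variables (R : realType) (n : nat) (hn : (0 < n)%N).
Implicit Types x : 'I_n -> R.
Let w : R := 2 * pi / n%:R.
(** Up to sign, [fc x k] and [fs x k] are the real and imaginary parts of the [k]-th discrete
    Fourier coefficient of [x]. *)
Let fc x (k : nat) := \sum_(i < n) x i * cos (k%:R * (w * i%:R)).
Let fs x (k : nat) := \sum_(i < n) x i * sin (k%:R * (w * i%:R)).

Let n0 : n%:R != 0 :> R. Proof. by rewrite pnatr_eq0 -lt0n. Qed.

Let trig_ordS k (i : 'I_n) :
  cos (k%:R * (w * (ordS i)%:R)) = cos (k%:R * (w * i%:R) + k%:R * w) /\
  sin (k%:R * (w * (ordS i)%:R)) = sin (k%:R * (w * i%:R) + k%:R * w).
Proof.
have -> : k%:R * (w * i%:R) + k%:R * w = k%:R * (w * i.+1%:R).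
  by rewrite -natr1; ring.
rewrite /=; have := ltn_ord i; rewrite leq_eqVlt => /predU1P[->|iln]; last first.
  by rewrite modn_small.
rewrite modnn !mulr0 cos0 sin0.
have -> : k%:R * (w * n%:R) = 0 + pi *+ 2 *+ k.
  by rewrite /w pi2_mulrn; field.
by rewrite (periodicn (@sinD2pi R)) (periodicn (@cosD2pi R)) cos0 sin0.
Qed.

(** A cyclic shift rotates the [k]-th coefficient by the angle [k * w], so taking differences
    multiplies it by a complex number of squared modulus [2 - 2 * cos (k * w)]. *)
Let fourier_diff x k :
  fc (fun i => x (ordS i) - x i) k ^+ 2 + fs (fun i => x (ordS i) - x i) k ^+ 2
  = (2 - 2 * cos (k%:R * w)) * (fc x k ^+ 2 + fs x k ^+ 2).
Proof.
have C : fc (fun i => x (ordS i)) k = cos (k%:R * w) * fc x k + sin (k%:R * w) * fs x k.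
  rewrite /fc /fs !mulr_sumr -big_split /= -[RHS]sum_ordS; apply: eq_bigr => i _.
  have [-> ->] := trig_ordS k i; rewrite cosD sinD.
  have := cos2Dsin2 (k%:R * w); set C := cos (k%:R * w); set S := sin (k%:R * w).
  set c := cos _; set s := sin _ => H.
  transitivity (x (ordS i) * (c * (C^+2 + S^+2))); last by ring.
  by rewrite H mulr1.
have S : fs (fun i => x (ordS i)) k = cos (k%:R * w) * fs x k - sin (k%:R * w) * fc x k.
  rewrite /fc /fs !mulr_sumr -sumrB /= -[RHS]sum_ordS; apply: eq_bigr => i _.
  have [-> ->] := trig_ordS k i; rewrite cosD sinD.
  have := cos2Dsin2 (k%:R * w); set C' := cos (k%:R * w); set S := sin (k%:R * w).
  set c := cos _; set s := sin _ => H.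
  transitivity (x (ordS i) * (s * (C'^+2 + S^+2))); last by ring.
  by rewrite H mulr1.
have -> : fc (fun i => x (ordS i) - x i) k = fc (fun i => x (ordS i)) k - fc x k.
  by rewrite /fc -sumrB; apply: eq_bigr => i _; rewrite mulrBl.
have -> : fs (fun i => x (ordS i) - x i) k = fs (fun i => x (ordS i)) k - fs x k.
  by rewrite /fs -sumrB; apply: eq_bigr => i _; rewrite mulrBl.
rewrite C S; have := cos2Dsin2 (k%:R * w).
set c := cos _; set s := sin _ => H.
have -> : 2 - 2 * c = (c ^+ 2 + s ^+ 2) + 1 - 2 * c by rewrite H; ring.
by ring.
Qed.

(** Expanding the squares gives a double sum over [i] and [j] of cosines of differences; after
    summation over [k] the off-diagonal terms vanish by [sum_cos_eq0]. *)
Let parseval x :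
  \sum_(k < n) (fc x k ^+ 2 + fs x k ^+ 2) = n%:R * \sum_(i < n) x i ^+ 2.
Proof.
transitivity (\sum_(k < n) \sum_(i < n) \sum_(j < n)
    x i * x j * cos (k%:R * (w * i%:R) - k%:R * (w * j%:R))).
  apply: eq_bigr => k _; rewrite !expr2 /fc /fs !mulr_suml -big_split /=.
  apply: eq_bigr => i _; rewrite !mulr_sumr -big_split /=.
  by apply: eq_bigr => j _; rewrite cosB; ring.
rewrite exchange_big /= mulr_sumr; apply: eq_bigr => i _.
rewrite exchange_big /= (bigD1 i)//= [X in _ + X]big1 ?addr0.
  under eq_bigr do rewrite subrr cos0 mulr1.
  by rewrite sumr_const card_ord -expr2 -[LHS]mulr_natl.
move=> j ji; rewrite -mulr_sumr.
have [ij|ij] := ltnP i j.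
  rewrite (eq_bigr (fun k : 'I_n => cos (k%:R * (w * (j - i)%:R)))).
    by rewrite sum_cos_eq0 ?mulr0// subn_gt0 ij (leq_ltn_trans (leq_subr _ _)).
  by move=> k _; rewrite natrB ?(ltnW ij)// -cosN; congr cos; ring.
rewrite (eq_bigr (fun k : 'I_n => cos (k%:R * (w * (i - j)%:R)))).
  rewrite sum_cos_eq0 ?mulr0// subn_gt0 ltn_neqAle ij andbT.
  by rewrite (leq_ltn_trans (leq_subr _ _))// andbT.
by move=> k _; rewrite natrB//; congr cos; ring.
Qed.

(** By [parseval] and [fourier_diff] the comparison is made frequency by frequency. Frequency 0
    vanishes by hypothesis; among the others [2 - 2 * cos (k * w)] is least at [k = 1], where it is
    [4 * sin (pi / n) ^+ 2]. *)
Lemma discrete_wirtinger x : \sum_(i < n) x i = 0 ->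
  4 * sin (pi / n%:R) ^+ 2 * \sum_(i < n) x i ^+ 2
  <= \sum_(i < n) (x (ordS i) - x i) ^+ 2.
Proof.
move=> x0; rewrite -(ler_pM2l (_ : 0 < n%:R)) ?ltr0n//.
rewrite mulrCA -!parseval mulr_sumr; apply: ler_sum => k _.
rewrite fourier_diff.
have [k0|k0] := posnP k.
  suff [-> ->] : fc x k = 0 /\ fs x k = 0 by rewrite expr0n /= addr0 !mulr0.
  rewrite /fc /fs k0; split; last by rewrite big1// => i _; rewrite mul0r sin0 mulr0.
  by rewrite -[RHS]x0; apply: eq_bigr => i _; rewrite mul0r cos0 mulr1.
apply: ler_wpM2r; first by rewrite addr_ge0// sqr_ge0.
have h1 : 2 - 2 * cos (2 * (pi / n%:R)) = 4 * sin (pi / n%:R) ^+ 2 :> R.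
  by rewrite [2 * (pi / _)]mulr_natl cos_mulr2n sin2cos2; ring.
rewrite -h1 lerD2l lerN2 ler_pM2l//.
(* The frequencies [k] and [n - k] have the same cosine; the smaller one has its angle in [[0, pi]],
   where the cosine decreases. *)
pose m := minn k (n - k).
have mn : (0 < m <= n)%N.
  rewrite /m leq_min k0 subn_gt0 ltn_ord /= geq_min; apply/orP; left.
  exact/ltnW/ltn_ord.
have m2 : (m.*2 <= n)%N.
  rewrite -addnn /m -[leqRHS](subnK (ltnW (ltn_ord k))).
  by rewrite leq_add// ?geq_minl ?geq_minr.
have -> : cos (k%:R * w) = cos (m%:R * w).
  rewrite /m /minn; case: ifP => // _.
  rewrite natrB; last exact/ltnW/ltn_ord.
  rewrite -[RHS]cosN.
  have -> : - ((n%:R - k%:R) * w) = k%:R * w - pi *+ 2.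
    by rewrite /w -[pi *+ 2]mulr_natl; field.
  by rewrite -[RHS]cosD2pi subrK.
have nR : 0 < n%:R :> R by rewrite ltr0n.
have itv (j : nat) : (0 < j)%N -> (j.*2 <= n)%N -> j%:R * w \in `[0, pi].
  move=> j0 jn; rewrite in_itv /= /w; apply/andP; split.
    by rewrite mulr_ge0// divr_ge0// mulr_ge0// pi_ge0.
  have -> : j%:R * (2 * pi / n%:R) = pi * (j.*2%:R / n%:R) :> R.
    by rewrite -muln2 natrM; field.
  by rewrite ger_pMr ?pi_gt0// ler_pdivrMr// mul1r ler_nat.
have -> : 2 * (pi / n%:R) = 1%:R * w by rewrite /w; field.
have [m0 _] := andP mn.
case: (ltngtP 1 m) m0 => // [m1 _|<- //]; apply: ltW.
have i1 : 1%:R * w \in `[0, pi].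
  have n2 : (1.*2 <= n)%N by apply: leq_trans _ m2; rewrite leq_double ltnW.
  exact: (itv 1%N isT n2).
rewrite (ltr_cos i1 (itv m (ltnW m1) m2)).
by rewrite ltr_pM2r ?ltr_nat// /w divr_gt0// mulr_gt0// pi_gt0.
Qed.

End Fourier.

(** * Closed paths *)

Lemma ler_of_sqr (R : realDomainType) (a b : R) :
  0 <= b -> a ^+ 2 <= b ^+ 2 -> a <= b.
Proof.
move=> b0; apply: contraTT; rewrite -!ltNge => ba.
by rewrite ltr_pXn2r// nnegrE// (le_trans b0 (ltW ba)).
Qed.

Lemma dist2_ge0 (R : realType) (p q : R * R) : 0 <= dist2 p q.
Proof. exact: sqrtr_ge0. Qed.

Lemma dist2_sqr (R : realType) (p q : R * R) :
  dist2 p q ^+ 2 = (p.1 - q.1) ^+ 2 + (p.2 - q.2) ^+ 2.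
Proof. by rewrite sqr_sqrtr// addr_ge0// sqr_ge0. Qed.

Lemma dist2C (R : realType) (p q : R * R) : dist2 p q = dist2 q p.
Proof. by rewrite /dist2 -sqrrN -[(p.2 - _) ^+ 2]sqrrN !opprB. Qed.

(** Squaring reduces this to Cauchy-Schwarz, which is Lagrange's identity: the gap between its
    squared sides is the square of a cross product. *)
Lemma dist2_triangle (R : realType) (p q r : R * R) :
  dist2 p r <= dist2 p q + dist2 q r.
Proof.
apply: ler_of_sqr; first by rewrite addr_ge0 ?dist2_ge0.
rewrite dist2_sqr [leRHS]sqrrD !dist2_sqr.
suff : (p.1 - q.1) * (q.1 - r.1) + (p.2 - q.2) * (q.2 - r.2)
    <= dist2 p q * dist2 q r by lra.
apply: ler_of_sqr; first by rewrite mulr_ge0 ?dist2_ge0.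
rewrite exprMn !dist2_sqr -subr_ge0.
set E := (X in 0 <= X).
have -> : E = ((p.1 - q.1) * (q.2 - r.2) - (p.2 - q.2) * (q.1 - r.1)) ^+ 2.
  by rewrite /E; ring.
exact: sqr_ge0.
Qed.

Definition cross (R : realType) (p q : R * R) : R := p.1 * q.2 - p.2 * q.1.

Section ClosedPath.
Variables (R : realType) (n : nat).
Implicit Types A : 'I_n -> R * R.

Definition path_length A : R := \sum_(i < n) dist2 (A i) (A (ordS i)).

Definition path_energy A : R := \sum_(i < n) dist2 (A i) (A (ordS i)) ^+ 2.

Definition shoelace A : R := 2^-1 * \sum_(i < n) cross (A i) (A (ordS i)).

Definition centroid A : R * R := n%:R^-1 *: \sum_(i < n) A i.

(* In complex notation the summand is [|(A' - A) - i t (A' + A)| ^ 2], where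
   [A'] follows [A]; for [t = tan (pi / n)] it vanishes exactly when [A'] is
   [A] rotated by [2 pi / n] about the origin. *)
Definition turn_defect (t : R) A : R := \sum_(i < n)
  (((A (ordS i)).1 - (A i).1 + t * ((A i).2 + (A (ordS i)).2)) ^+ 2
   + ((A (ordS i)).2 - (A i).2 - t * ((A i).1 + (A (ordS i)).1)) ^+ 2).

Lemma path_length_ge0 A : 0 <= path_length A.
Proof. by apply: sumr_ge0 => i _; exact: dist2_ge0. Qed.

Lemma path_energy_ge0 A : 0 <= path_energy A.
Proof. by apply: sumr_ge0 => i _; exact: sqr_ge0. Qed.

Lemma turn_defect_ge0 t A : 0 <= turn_defect t A.
Proof. by apply: sumr_ge0 => i _; rewrite addr_ge0 ?sqr_ge0. Qed.

Lemma path_length_shift A c : path_length (fun i => A i - c) = path_length A.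
Proof.
apply: eq_bigr => i _; rewrite /dist2 /=.
by congr (Num.sqrt (_ ^+ 2 + _ ^+ 2)); ring.
Qed.

Lemma path_energy_shift A c : path_energy (fun i => A i - c) = path_energy A.
Proof.
by apply: eq_bigr => i _; rewrite !dist2_sqr /=; congr (_ ^+ 2 + _ ^+ 2); ring.
Qed.

Lemma shoelace_shift A c : shoelace (fun i => A i - c) = shoelace A.
Proof.
rewrite /shoelace; congr (_ * _).
rewrite (eq_bigr (fun i => cross (A i) (A (ordS i))
    + (cross c (A i) - cross c (A (ordS i))))); last first.
  by move=> i _; rewrite /cross /=; ring.
rewrite big_split /= [X in _ + X]sumrB; have /= -> := sum_ordS (fun i => cross c (A i)).
by rewrite subrr addr0.
Qed.

Lemma path_energy_center A :
  path_energy A = \sum_(i < n) ((A (ordS i)).1 - (A i).1) ^+ 2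
    + \sum_(i < n) ((A (ordS i)).2 - (A i).2) ^+ 2.
Proof.
rewrite -big_split /=; apply: eq_bigr => i _.
by rewrite dist2C dist2_sqr.
Qed.

Lemma turn_defectE t A :
  turn_defect t A = (1 - t ^+ 2) * path_energy A
    + 4 * t ^+ 2 * \sum_(i < n) ((A i).1 ^+ 2 + (A i).2 ^+ 2)
    - 8 * t * shoelace A.
Proof.
pose N i := (A i).1 ^+ 2 + (A i).2 ^+ 2.
have -> : 4 * t ^+ 2 * \sum_(i < n) N i
    = \sum_(i < n) 2 * t ^+ 2 * (N i + N (ordS i)).
  rewrite -mulr_sumr [X in _ = _ * X]big_split /=.
  by have /= -> := sum_ordS N; ring.
have -> : 8 * t * shoelace A = \sum_(i < n) 4 * t * cross (A i) (A (ordS i)).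
  by rewrite /shoelace -mulr_sumr; field.
rewrite /path_energy mulr_sumr -big_split -sumrB /=; apply: eq_bigr => i _.
by rewrite dist2_sqr /cross /N; ring.
Qed.

Lemma tan_pi_div_gt0 : (3 <= n)%N -> 0 < tan (pi / n%:R) :> R.
Proof.
move=> n3; have n0 : 0 < n%:R :> R by rewrite ltr0n (leq_trans _ n3).
have h : 0 < (pi : R) / n%:R < pi / 2.
  rewrite divr_gt0 ?pi_gt0//= ltr_pM2l ?pi_gt0// ltf_pV2 ?posrE//.
  by rewrite ltr_nat.
apply: divr_gt0; first exact: sin_gt0_pihalf.
apply: cos_gt0_pihalf; move: h => /andP[h1 ->]; rewrite andbT.
by rewrite (lt_trans _ h1)// oppr_lt0 divr_gt0 ?pi_gt0.
Qed.

Lemma sin2_tan2 (x : R) : cos x != 0 ->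
  sin x ^+ 2 * (1 + tan x ^+ 2) = tan x ^+ 2.
Proof. by move=> c0; rewrite -cos2_tan2// /tan exprMn exprVn. Qed.

Lemma cos_pi_div_neq0 : (3 <= n)%N -> cos (pi / n%:R) != 0 :> R.
Proof.
move=> /tan_pi_div_gt0; rewrite /tan; apply: contraTneq => ->.
by rewrite invr0 mulr0 ltxx.
Qed.

(** Wirtinger in both coordinates gives [4 * s ^+ 2 * N <= path_energy A]. Multiplying by
    [1 + t ^+ 2] turns [s ^+ 2] into [t ^+ 2], which bounds the middle term of [turn_defectE]. *)
Lemma turn_defect_le A : (3 <= n)%N -> \sum_(i < n) A i = 0 ->
  turn_defect (tan (pi / n%:R)) A
  <= 2 * (path_energy A - 4 * tan (pi / n%:R) * shoelace A).
Proof.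
move=> n3 A0; have n0 : (0 < n)%N by rewrite (leq_trans _ n3).
rewrite turn_defectE; have := sin2_tan2 (cos_pi_div_neq0 n3).
set t := tan _; set s := sin _ => st.
have A1 : \sum_(i < n) (A i).1 = 0.
  by rewrite -[LHS](raddf_sum fst) A0.
have A2 : \sum_(i < n) (A i).2 = 0.
  by rewrite -[LHS](raddf_sum snd) A0.
have := lerD (discrete_wirtinger n0 A1) (discrete_wirtinger n0 A2).
rewrite -path_energy_center -mulrDr -big_split /= -/s.
set N := \sum_(i < n) _ => H.
have : (4 * s ^+ 2 * N) * (1 + t ^+ 2) <= path_energy A * (1 + t ^+ 2).
  by rewrite ler_wpM2r// addr_ge0// sqr_ge0.
have -> : 4 * s ^+ 2 * N * (1 + t ^+ 2) = 4 * (s ^+ 2 * (1 + t ^+ 2)) * N by ring.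
by rewrite st; lra.
Qed.

End ClosedPath.

Lemma turn_defect_eq0 (R : realType) (n : nat) (t : R) (A : 'I_n -> R * R)
    (i : 'I_n) : turn_defect t A = 0 ->
  (1 + t ^+ 2) * cross (A (ordS i) - A i) (A (ordS (ordS i)) - A (ordS i))
  = 2 * t * dist2 (A i) (A (ordS i)) ^+ 2.
Proof.
move=> /eqP; rewrite psumr_eq0; last by move=> k _; rewrite addr_ge0 ?sqr_ge0.
move=> /allP H.
have K k : (A (ordS k)).1 - (A k).1 = - (t * ((A k).2 + (A (ordS k)).2))
        /\ (A (ordS k)).2 - (A k).2 = t * ((A k).1 + (A (ordS k)).1).
  have := H k (mem_index_enum k); rewrite paddr_eq0 ?sqr_ge0// !sqrf_eq0.
  by move=> /andP[/eqP h1 /eqP h2]; split; lra.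
have [a1 a2] := K i; have [b1 b2] := K (ordS i).
rewrite dist2C dist2_sqr /cross /=.
move: a1 a2 b1 b2.
move: (A i) (A (ordS i)) (A (ordS (ordS i))) => [x y] [x' y'] [x'' y''] /=.
move=> a1 a2 b1 b2.
(* In complex notation [E1] and [E2] say that [1 - i t] times the next side is [1 + i t] times the
   current one: the sides turn by a constant angle. *)
have E1 : (x'' - x') + t * (y'' - y') = (x' - x) - t * (y' - y) by lra.
have E2 : (y'' - y') - t * (x'' - x') = (y' - y) + t * (x' - x) by lra.
transitivity ((x' - x) * (((y'' - y') - t * (x'' - x')) + t * ((x'' - x') + t * (y'' - y')))
   - (y' - y) * (((x'' - x') + t * (y'' - y')) - t * ((y'' - y') - t * (x'' - x')))).
  by ring.
by rewrite E1 E2; ring.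
Qed.

(** With [u = p - c] and [v = q - c] as complex numbers, the right side is
    [|(1 - i t) v - (1 + i t) u| ^ 2]. Both factors have squared modulus [1 + t ^+ 2], which is at
    least 1, so the reverse triangle inequality applies. *)
Lemma sqr_radius_diff_le (R : realType) (t : R) (c p q : R * R) :
  (dist2 c q - dist2 c p) ^+ 2 <=
  ((q - c).1 - (p - c).1 + t * ((p - c).2 + (q - c).2)) ^+ 2
  + ((q - c).2 - (p - c).2 - t * ((p - c).1 + (q - c).1)) ^+ 2.
Proof.
have := dist2_sqr c p; have := dist2_sqr c q.
have := dist2_ge0 c p; have := dist2_ge0 c q.
set r' := dist2 c q; set r := dist2 c p; rewrite /=.
set u1 := p.1 - c.1; set u2 := p.2 - c.2; set v1 := q.1 - c.1; set v2 := q.2 - c.2.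
rewrite -(opprB q.1) -(opprB q.2) -(opprB p.1) -(opprB p.2) !sqrrN -/u1 -/u2 -/v1 -/v2.
move=> r'0 r0 hr' hr.
have key : (1 - t ^+ 2) * (u1 * v1 + u2 * v2) + 2 * t * (u1 * v2 - u2 * v1)
    <= (1 + t ^+ 2) * (r * r').
  apply: ler_of_sqr; first by rewrite !mulr_ge0// addr_ge0// sqr_ge0.
  rewrite [leRHS]exprMn exprMn hr hr' -subr_ge0.
  set E := (X in 0 <= X).
  have -> : E = ((1 - t ^+ 2) * (u1 * v2 - u2 * v1) - 2 * t * (u1 * v1 + u2 * v2)) ^+ 2.
    by rewrite /E; ring.
  exact: sqr_ge0.
have h : 0 <= t ^+ 2 * (r' - r) ^+ 2 by rewrite mulr_ge0 ?sqr_ge0.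
have -> : (v1 - u1 + t * (u2 + v2)) ^+ 2 + (v2 - u2 - t * (u1 + v1)) ^+ 2
    = (1 + t ^+ 2) * ((u1 ^+ 2 + u2 ^+ 2) + (v1 ^+ 2 + v2 ^+ 2))
      - 2 * ((1 - t ^+ 2) * (u1 * v1 + u2 * v2) + 2 * t * (u1 * v2 - u2 * v1)).
  by ring.
rewrite -hr -hr'; lra.
Qed.

(** The discrete Wirtinger inequality applies to the deviations [x] from the mean, whose squares sum
    to [n] times the variance. *)
Lemma variance_le (R : realType) (n : nat) (r : 'I_n -> R) : (3 <= n)%N ->
  n%:R^-1 * (\sum_(i < n) r i ^+ 2) - (n%:R ^+ 2)^-1 * (\sum_(i < n) r i) ^+ 2
  <= (4 * n%:R * sin (pi / n%:R) ^+ 2)^-1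
     * \sum_(i < n) (r (ordS i) - r i) ^+ 2.
Proof.
move=> n3; have n0 : (0 < n)%N by rewrite (leq_trans _ n3).
have nR : 0 < n%:R :> R by rewrite ltr0n.
pose m := n%:R^-1 * \sum_(i < n) r i; pose x i := r i - m.
have x0 : \sum_(i < n) x i = 0.
  rewrite sumrB sumr_const card_ord /m -[X in _ - X]mulr_natl mulrA.
  by rewrite divff ?gt_eqF// mul1r subrr.
have := discrete_wirtinger n0 x0.
rewrite [X in _ <= X](eq_bigr (fun i => (r (ordS i) - r i) ^+ 2)); last first.
  by move=> i _; congr (_ ^+ 2); rewrite /x; ring.
have -> : \sum_(i < n) x i ^+ 2
    = n%:R * (n%:R^-1 * (\sum_(i < n) r i ^+ 2)
              - (n%:R ^+ 2)^-1 * (\sum_(i < n) r i) ^+ 2).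
  rewrite (eq_bigr (fun i => r i ^+ 2 + (m ^+ 2 - 2 * m * r i))); last first.
    by move=> i _; rewrite /x; ring.
  have e : \sum_(i < n) 2 * m * r i = 2 * m * \sum_(i < n) r i by rewrite mulr_sumr.
  rewrite big_split /= [X in _ + X = _]sumrB e sumr_const card_ord -[_ *+ n]mulr_natl /m.
  by field; rewrite gt_eqF.
have s0 : 0 < sin (pi / n%:R) ^+ 2 :> R.
  have := tan_pi_div_gt0 R n3; rewrite /tan exprn_even_gt0//=.
  by apply: contraTneq => ->; rewrite mul0r ltxx.
move=> H; rewrite ler_pdivlMl; last by apply: mulr_gt0 => //; rewrite mulr_gt0.
by apply: le_trans H; rewrite le_eqVlt; apply/orP; left; apply/eqP; ring.
Qed.

Lemma var_radii_le (R : realType) (n : nat) (A : 'I_n -> R * R) :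
  (3 <= n)%N ->
  n%:R^-1 * (\sum_(i < n) dist2 (centroid A) (A i) ^+ 2)
    - (n%:R ^+ 2)^-1 * (\sum_(i < n) dist2 (centroid A) (A i)) ^+ 2
  <= (4 * n%:R * sin (pi / n%:R) ^+ 2)^-1
     * (2 * (path_energy A - 4 * tan (pi / n%:R) * shoelace A)).
Proof.
move=> n3; apply: le_trans (variance_le _ n3) _.
apply: ler_wpM2l.
  by rewrite invr_ge0; apply: mulr_ge0 (sqr_ge0 _); rewrite mulr_ge0.
set c := centroid A.
rewrite -(path_energy_shift A c) -(shoelace_shift A c).
apply: le_trans (turn_defect_le n3 _).
  by apply: ler_sum => i _; exact: sqr_radius_diff_le.
rewrite sumrB sumr_const card_ord /c /centroid.
rewrite -scaler_nat scalerA divff ?scale1r ?subrr//.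
by rewrite pnatr_eq0 -lt0n (leq_trans _ n3).
Qed.

(** * Symmetrization of a vertex *)

(** The point [q] is [p] slid parallel to [ab] onto the perpendicular bisector of [ab]. The third
    clause makes the gain in length quantitative, with a factor that degenerates only with the
    triangle [apb]. *)
Lemma symmetric_apex (R : realType) (a p b : R * R) :
  dist2 a p + dist2 p b <= 1 ->
  exists q, [/\ cross a q + cross q b = cross a p + cross p b,
    0 <= (dist2 a p ^+ 2 + dist2 p b ^+ 2) - (dist2 a q ^+ 2 + dist2 q b ^+ 2),
    4 * cross (p - a) (b - p) ^+ 2 *
      ((dist2 a p ^+ 2 + dist2 p b ^+ 2) - (dist2 a q ^+ 2 + dist2 q b ^+ 2))
      <= (dist2 a p + dist2 p b) - (dist2 a q + dist2 q b) &
    (dist2 a p ^+ 2 + dist2 p b ^+ 2) - (dist2 a q ^+ 2 + dist2 q b ^+ 2) = 0 ->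
      dist2 a p = dist2 p b].
Proof.
move=> uv1.
pose d := (b.1 - a.1) ^+ 2 + (b.2 - a.2) ^+ 2.
pose g := (p.1 - (a.1 + b.1) / 2) * (b.1 - a.1) + (p.2 - (a.2 + b.2) / 2) * (b.2 - a.2).
(* If [a = b] then [g = 0], and division by 0 gives [s = 0], hence [q = p]; so [s * d = g] holds in
   every case. *)
pose s := g / d.
have d0 : 0 <= d by rewrite addr_ge0 ?sqr_ge0.
have sd : s * d = g.
  have [dz|dn] := eqVneq d 0; last by rewrite divfK.
  move/eqP: (dz); rewrite paddr_eq0 ?sqr_ge0// !sqrf_eq0 => /andP[/eqP h1 /eqP h2].
  by rewrite dz /g h1 h2 !mulr0 addr0.
pose q : R * R := (p.1 - s * (b.1 - a.1), p.2 - s * (b.2 - a.2)).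
have hu := dist2_sqr a p; have hv := dist2_sqr p b.
have u0 := dist2_ge0 a p; have v0 := dist2_ge0 p b.
have hm := dist2_sqr a q; have m0 := dist2_ge0 a q.
have mm : dist2 q b = dist2 a q.
  apply/eqP; rewrite -(@eqrXn2 _ 2)// ?dist2_ge0//; apply/eqP.
  rewrite !dist2_sqr /= -[RHS]addr0 -[X in _ = _ + X](subrr (2 * (s * d))) {2}sd /g /d.
  by field.
exists q; rewrite mm.
have eS : dist2 a p ^+ 2 + dist2 p b ^+ 2 = 2 * dist2 a q ^+ 2 + 2 * (s ^+ 2 * d).
  have -> : 2 * (s ^+ 2 * d)
      = 4 * s * (s * d) - 2 * (s ^+ 2 * d) - 2 * (s * d) + 2 * s * d by ring.
  by rewrite sd hu hv hm /= /g /d; field.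
have eD : dist2 a p ^+ 2 - dist2 p b ^+ 2 = 2 * (s * d).
  by rewrite sd hu hv /g; field.
have eX : cross (p - a) (b - p) ^+ 2 = d * (dist2 a q ^+ 2 - d / 4).
  have -> : d * (dist2 a q ^+ 2 - d / 4)
   = d * ((p.1 - a.1) ^+ 2 + (p.2 - a.2) ^+ 2 - d / 4)
     - 2 * (s * d) * ((p.1 - a.1) * (b.1 - a.1) + (p.2 - a.2) * (b.2 - a.2)) + (s * d) ^+ 2.
    by rewrite hm /= /d; field.
  by rewrite sd /cross /g /d /=; field.
have h0 : 0 <= dist2 a q ^+ 2 - d / 4.
  have [dz|dn] := eqVneq d 0; first by rewrite dz mul0r subr0 sqr_ge0.
  have : 0 < d by rewrite lt0r dn.
  by move=> dp; rewrite -(pmulr_rge0 _ dp) -eX sqr_ge0.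
split; first by rewrite /cross /q /=; ring.
- by rewrite eS; have := mulr_ge0 (sqr_ge0 s) d0; lra.
- rewrite eX eS.
  have k0 := mulr_ge0 (sqr_ge0 s) d0.
  have euv : (dist2 a p * dist2 p b) ^+ 2
      = (dist2 a q ^+ 2 + s ^+ 2 * d) ^+ 2 - d * (s ^+ 2 * d).
    have -> : (dist2 a p * dist2 p b) ^+ 2 = ((dist2 a p ^+ 2 + dist2 p b ^+ 2) / 2) ^+ 2
       - ((dist2 a p ^+ 2 - dist2 p b ^+ 2) / 2) ^+ 2 by field.
    by rewrite eS eD; field.
  (* For [a] distinct from [b], [h] is the squared height of the triangle over [ab]. Below,
     [k = s ^+ 2 * d] is half the loss of energy. *)
  have [h hE] : exists h, h = dist2 a q ^+ 2 - d / 4 by eexists.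
  have dE : d = 4 * (dist2 a q ^+ 2 - h) by lra.
  rewrite -hE in h0 *.
  have d1 : dist2 a b <= 1 by apply: le_trans (dist2_triangle a p b) uv1.
  have {}d1 : d <= 1.
    rewrite /d; have := dist2_sqr b a; rewrite dist2C => <-.
    by rewrite expr_le1// dist2_ge0.
  move: (dist2 a p) (dist2 p b) (dist2 a q) (s ^+ 2 * d)
    uv1 u0 v0 m0 eS k0 euv dE => u v m k uv1 u0 v0 m0 eS k0 euv dE.
  have uv0 := mulr_ge0 u0 v0.
  have w1 : m ^+ 2 - k <= u * v.
    apply: ler_of_sqr => //; rewrite euv dE; have := mulr_ge0 h0 k0; lra.
  have m1 : 2 * m <= u + v.
    apply: ler_of_sqr; first exact: addr_ge0.
    lra.
  have m4 : 4 * m ^+ 2 <= 1.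
    have : (2 * m) ^+ 2 <= 1 by rewrite expr_le1 ?mulr_ge0//; lra.
    by lra.
  have h4 : 4 * h <= 1 by lra.
  have hk := mulr_ge0 h0 k0.
  (* The bound [w1] yields only [2 * m <= u + v]; the extra [8 * (h * k)] gives [w3], and division
     by [u + v + 2 * m <= 2] then gives [8 * (h * k) <= u + v - 2 * m]. *)
  have w2 : m ^+ 2 - k + 8 * (h * k) <= u * v.
    apply: ler_of_sqr => //; rewrite euv dE -subr_ge0.
    set E := (X in 0 <= X).
    have -> : E = 4 * (h * k) * ((1 - 4 * m ^+ 2) + 4 * k * (1 - 4 * h)).
      rewrite /E; ring.
    apply: mulr_ge0; first lra.
    by apply: addr_ge0; [lra|apply: mulr_ge0; lra].
  have w3 : 16 * (h * k) <= (u + v - 2 * m) * (u + v + 2 * m) by lra.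
  have w4 : (u + v - 2 * m) * (u + v + 2 * m) <= (u + v - 2 * m) * 2.
    by apply: ler_wpM2l; lra.
  have w5 : d * (h * k) <= h * k by rewrite ler_piMl.
  lra.
- rewrite eS => H; have {}H : s ^+ 2 * d = 0 by lra.
  have sd0 : s * d = 0.
    by move/eqP: H; rewrite mulf_eq0 sqrf_eq0 => /orP[] /eqP ->; rewrite ?mul0r ?mulr0.
  by apply/eqP; rewrite -(@eqrXn2 _ 2)//; apply/eqP; lra.
Qed.

Section MoveVertex.
Variables (R : realType) (n : nat) (A : 'I_n -> R * R) (i : 'I_n).
Hypothesis n3 : (3 <= n)%N.

Lemma ordS_neq (j : 'I_n) : ordS j != j.
Proof.
rewrite -val_eqE /=; have := ltn_ord j; rewrite leq_eqVlt => /predU1P[jn|jn].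
  by rewrite jn modnn; apply: contraTneq n3 => j0; rewrite -jn -j0.
by rewrite modn_small// gtn_eqF.
Qed.

(** The vertex that moves is [ordS i], so that both of its neighbours, [i] and [ordS (ordS i)], are
    written with the successor alone. *)
Definition move_vertex (q : R * R) : 'I_n -> R * R :=
  fun l => if l == ordS i then q else A l.

Lemma sum_move_vertex (f : R * R -> R * R -> R) (q : R * R) :
  \sum_(l < n) f (move_vertex q l) (move_vertex q (ordS l))
  = \sum_(l < n) f (A l) (A (ordS l))
    + (f (A i) q + f q (A (ordS (ordS i)))
       - (f (A i) (A (ordS i)) + f (A (ordS i)) (A (ordS (ordS i))))).
Proof.
have ik : ordS i != i := ordS_neq i.
rewrite (bigD1 i)//= (bigD1 (ordS i))//= [in RHS](bigD1 i)//= [in RHS](bigD1 (ordS i))//=.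
rewrite (eq_bigr (fun l => f (A l) (A (ordS l)))); last first.
  move=> l /andP[li lk]; rewrite /move_vertex (negbTE lk).
  by rewrite (inj_eq (@ordS_inj n)) (negbTE li).
rewrite /move_vertex eqxx (negbTE (ordS_neq _)) eq_sym (negbTE ik) .
by ring.
Qed.

Lemma path_length_move q : path_length (move_vertex q) = path_length A
  + (dist2 (A i) q + dist2 q (A (ordS (ordS i)))
     - (dist2 (A i) (A (ordS i)) + dist2 (A (ordS i)) (A (ordS (ordS i))))).
Proof. exact: sum_move_vertex. Qed.

Lemma path_energy_move q : path_energy (move_vertex q) = path_energy A
  + (dist2 (A i) q ^+ 2 + dist2 q (A (ordS (ordS i))) ^+ 2
     - (dist2 (A i) (A (ordS i)) ^+ 2
        + dist2 (A (ordS i)) (A (ordS (ordS i))) ^+ 2)).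
Proof. exact: (sum_move_vertex (fun p q => dist2 p q ^+ 2)). Qed.

Lemma shoelace_move q : shoelace (move_vertex q) = shoelace A
  + 2^-1 * (cross (A i) q + cross q (A (ordS (ordS i)))
     - (cross (A i) (A (ordS i)) + cross (A (ordS i)) (A (ordS (ordS i))))).
Proof. by rewrite /shoelace sum_move_vertex mulrDr. Qed.

Lemma two_sides_le_length :
  dist2 (A i) (A (ordS i)) + dist2 (A (ordS i)) (A (ordS (ordS i)))
  <= path_length A.
Proof.
rewrite /path_length (bigD1 i)//= (bigD1 (ordS i)) ?ordS_neq//= addrA lerDl.
by apply: sumr_ge0 => l _; exact: dist2_ge0.
Qed.

(** Twice the signed area of the triangle spanned by the two sides at [ordS i]. *)
Definition corner : R :=
  cross (A (ordS i) - A i) (A (ordS (ordS i)) - A (ordS i)).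

Lemma symmetrize_vertex : path_length A = 1 ->
  exists B : 'I_n -> R * R, [/\ shoelace B = shoelace A, path_energy B <= path_energy A,
    4 * corner ^+ 2 * (path_energy A - path_energy B)
      <= path_length A - path_length B &
    path_energy B = path_energy A ->
      dist2 (A i) (A (ordS i)) = dist2 (A (ordS i)) (A (ordS (ordS i)))].
Proof.
move=> L1.
have [|q [q1 q2 q3 q4]] := @symmetric_apex R (A i) (A (ordS i)) (A (ordS (ordS i))).
  by rewrite -L1 two_sides_le_length.
exists (move_vertex q).
rewrite shoelace_move path_energy_move path_length_move q1 subrr mulr0 addr0.
split => //.
- lra.
- rewrite -/corner in q3; move: q3; set X := corner ^+ 2 => q3; lra.
- by move=> H; apply: q4; lra.
Qed.

(* Moving the vertex of a straight corner off its line gains area linearly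
   but length only quadratically. *)
Lemma push_straight_corner (c : R) : 0 < c -> path_length A = 1 ->
  corner = 0 -> A i != A (ordS (ordS i)) ->
  exists B : 'I_n -> R * R, path_length B ^+ 2 - c * shoelace B
            < path_length A ^+ 2 - c * shoelace A.
Proof.
move=> c0 L1 X0 ab.
pose a := A i; pose b := A (ordS (ordS i)); pose p := A (ordS i).
pose d := dist2 a b.
have d2 : d ^+ 2 = (b.1 - a.1) ^+ 2 + (b.2 - a.2) ^+ 2.
  by rewrite /d dist2C dist2_sqr.
have d0 : 0 < d.
  rewrite lt0r dist2_ge0 andbT; apply: contraNneq ab => dz.
  move/eqP: d2; rewrite dz expr0n/= eq_sym paddr_eq0 ?sqr_ge0// !sqrf_eq0 !subr_eq0.
  move=> /andP[/eqP e1 /eqP e2].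
  by rewrite -/a -/b; move: e1 e2; case: (a) => ? ?; case: (b) => ? ? /= -> ->.
have duv : d <= dist2 a p + dist2 p b := dist2_triangle a p b.
have d1 : d <= 1 by rewrite (le_trans duv)// -L1 two_sides_le_length.
(* The squared length grows by at most [8 * e ^+ 2 * d], while the area gain contributes
   [c * e * d ^+ 2 / 2]; with [e <= c * d / 32] the former is at most half of the latter. *)
pose e := Num.min 1 (c * d / 32).
have e0 : 0 < e by rewrite lt_min ltr01/= divr_gt0// mulr_gt0.
have e1 : e <= 1 by rewrite ge_min lexx.
have ec : e <= c * d / 32 by rewrite ge_min lexx orbT.
(* The midpoint of [ab], pushed perpendicularly by [e * d] to the side on which [shoelace]
   increases. *)
pose q : R * R := ((a.1 + b.1) / 2 + e * (b.2 - a.2), (a.2 + b.2) / 2 - e * (b.1 - a.1)).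
have qs (r : R * R) : r = a \/ r = b -> dist2 q r <= d / 2 + e ^+ 2 * d.
  move=> rE; apply: ler_of_sqr; first apply: addr_ge0; first lra.
    by apply: mulr_ge0; [exact: sqr_ge0|lra].
  have -> : dist2 q r ^+ 2 = d ^+ 2 / 4 + e ^+ 2 * d ^+ 2.
    by rewrite dist2_sqr d2; case: rE => ->; rewrite /=; field.
  have -> : (d / 2 + e ^+ 2 * d) ^+ 2 = d ^+ 2 / 4 + e ^+ 2 * d ^+ 2 + (e ^+ 2 * d) ^+ 2.
    by field.
  by rewrite lerDl sqr_ge0.
have qa := qs a (or_introl erefl); have qb := qs b (or_intror erefl).
rewrite dist2C in qa.
exists (move_vertex q).
have -> : shoelace (move_vertex q) = shoelace A + e * d ^+ 2 / 2.
  rewrite shoelace_move -/a -/b -/p; congr (_ + _).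
  have X1 : cross (p - a) (b - p) = 0 := X0.
  rewrite d2 -[RHS]subr0 -[X in _ = _ - X](mul0r 2^-1) -X1 /cross /q /=.
  by field.
set l := path_length _.
have l0 : 0 <= l := path_length_ge0 _.
have l1 : l <= 1 + 2 * e ^+ 2 * d.
  rewrite /l path_length_move L1 -/a -/b -/p; lra.
have ll : l ^+ 2 <= 1 + 8 * e ^+ 2 * d.
  have e2 : 0 <= e ^+ 2 <= 1 by rewrite sqr_ge0 expr_le1// ltW.
  have [e20 e21] := andP e2.
  have ed0 : 0 <= e ^+ 2 * d by rewrite mulr_ge0// ltW.
  have ed1 : e ^+ 2 * d <= 1 by rewrite mulr_ile1// ltW.
  have : l ^+ 2 <= (1 + 2 * (e ^+ 2 * d)) ^+ 2.
    by rewrite ler_pXn2r// ?nnegrE; lra.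
  have : (e ^+ 2 * d) ^+ 2 <= e ^+ 2 * d by rewrite expr2 ler_piMl.
  by lra.
rewrite L1 expr1n.
have : e * (e * d) <= e * (c * d / 32 * d).
  by rewrite ler_pM2l// ler_pM2r.
have : 0 < c * (e * d ^+ 2) by rewrite !mulr_gt0.
by lra.
Qed.

End MoveVertex.

(** * Compactness *)

Section PathTopology.
Variables (R : realType) (n : nat).
Local Notation path := (prod_topology (fun _ : 'I_n => (R * R)%type)).

Lemma continuous_sum (T : topologicalType) (I : Type) (s : seq I)
    (f : I -> T -> R) : (forall i, continuous (f i)) ->
  continuous (fun x => \sum_(i <- s) f i x).
Proof.
move=> cf; elim: s => [|i s IH] x.
  under eq_fun do rewrite big_nil; exact: cst_continuous.
under eq_fun do rewrite big_cons; apply: continuousD; [exact: cf|exact: IH].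
Qed.

Lemma continuous_vertex1 (k : 'I_n) : continuous (fun A : path => (A k).1).
Proof.
move=> A; apply: (@continuous_comp _ _ _ (fun A : path => A k) fst).
  exact: (@proj_continuous _ (fun _ : 'I_n => (R * R)%type) k).
exact: cvg_fst.
Qed.

Lemma continuous_vertex2 (k : 'I_n) : continuous (fun A : path => (A k).2).
Proof.
move=> A; apply: (@continuous_comp _ _ _ (fun A : path => A k) snd).
  exact: (@proj_continuous _ (fun _ : 'I_n => (R * R)%type) k).
exact: cvg_snd.
Qed.

Lemma continuous_dist2 (i j : 'I_n) :
  continuous (fun A : path => dist2 (A i) (A j)).
Proof.
move=> A; apply: (@continuous_comp _ _ _ (fun A : path =>
  ((A i).1 - (A j).1) ^+ 2 + ((A i).2 - (A j).2) ^+ 2) Num.sqrt).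
  apply: continuousD.
    by apply: (@continuousM _ _ (fun A : path => (A i).1 - (A j).1)
      (fun A : path => (A i).1 - (A j).1)); apply: continuousB;
      apply: continuous_vertex1.
  by apply: (@continuousM _ _ (fun A : path => (A i).2 - (A j).2)
      (fun A : path => (A i).2 - (A j).2)); apply: continuousB;
      apply: continuous_vertex2.
exact: sqrt_continuous.
Qed.

Lemma continuous_path_length : continuous (@path_length R n : path -> R).
Proof. by apply: continuous_sum => i; exact: continuous_dist2. Qed.

Lemma continuous_path_energy : continuous (@path_energy R n : path -> R).
Proof.
apply: continuous_sum => i A.
by apply: (@continuousM _ _ (fun A : path => dist2 (A i) (A (ordS i)))
  (fun A : path => dist2 (A i) (A (ordS i)))); exact: continuous_dist2.
Qed.

Lemma continuous_shoelace : continuous (@shoelace R n : path -> R).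
Proof.
move=> A; apply: (@continuousM _ _ (fun _ : path => 2^-1)
  (fun A : path => \sum_(i < n) cross (A i) (A (ordS i)))).
  exact: cst_continuous.
apply: continuous_sum => i {}A.
apply: (@continuousB _ _ _ (fun A : path => (A i).1 * (A (ordS i)).2)
  (fun A : path => (A i).2 * (A (ordS i)).1)); apply: continuousM;
  (exact: continuous_vertex1 || exact: continuous_vertex2).
Qed.

Lemma continuous_corner (i : 'I_n) :
  continuous ((fun A => corner A i) : path -> R).
Proof.
move=> A.
pose f k (A : path) := (A (ordS k)).1 - (A k).1.
pose g k (A : path) := (A (ordS k)).2 - (A k).2.
have cf k : continuous (f k).
  move=> B; apply: (@continuousB _ _ _ (fun A : path => (A (ordS k)).1)
    (fun A : path => (A k).1)); exact: continuous_vertex1.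
have cg k : continuous (g k).
  move=> B; apply: (@continuousB _ _ _ (fun A : path => (A (ordS k)).2)
    (fun A : path => (A k).2)); exact: continuous_vertex2.
apply: (@continuousB _ _ _ (fun A => f i A * g (ordS i) A)
  (fun A => g i A * f (ordS i) A)); apply: continuousM;
  (exact: cf || exact: cg).
Qed.

Lemma dist2_le_length (A : 'I_n -> R * R) (i0 j : 'I_n) : val i0 = 0 ->
  dist2 (A i0) (A j) <= path_length A.
Proof.
move=> i00; suff : dist2 (A i0) (A j)
    <= \sum_(l < n | (l < j)%N) dist2 (A l) (A (ordS l)).
  move/le_trans; apply; rewrite /path_length big_mkcond; apply: ler_sum => l _.
  by case: ifP => // _; exact: dist2_ge0.
case: j => m; elim: m => [|m IH] mn.
  have -> : Ordinal mn = i0 by apply: val_inj; rewrite i00.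
  by rewrite /dist2 !subrr expr0n/= addr0 sqrtr0 sumr_ge0// => *; exact: dist2_ge0.
have mn' := ltnW mn.
apply: le_trans (dist2_triangle _ (A (Ordinal mn')) _) _.
rewrite [leRHS](bigD1 (Ordinal mn'))//= [leRHS]addrC lerD//; last first.
  have -> // : ordS (Ordinal mn') = Ordinal mn.
  by apply: val_inj => /=; rewrite modn_small.
apply: le_trans (IH mn') _; rewrite le_eqVlt; apply/orP; left; apply/eqP.
apply: eq_bigl => l /=; rewrite ltnS -val_eqE /= [in RHS]leq_eqVlt.
by case: (ltngtP l m).
Qed.

(** Pinning one vertex at the origin removes translations. The other vertices are then within the
    length 1 of it, so the set is closed in a power of a square, compact by Tychonoff. *)
Lemma compact_unit_paths (i0 : 'I_n) : val i0 = 0 ->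
  compact [set A : path | A i0 = 0 /\ path_length A = 1].
Proof.
move=> i00.
pose I : set R := `[-1, 1]%classic.
have cI : compact (I `*` I) by apply: compact_setX; exact: segment_compact.
have cB := tychonoff (fun _ : 'I_n => cI).
apply: (subclosed_compact _ cB).
  have -> : [set A : path | A i0 = 0 /\ path_length A = 1]
      = (fun A : path => (A i0).1) @^-1` [set 0]
        `&` (fun A : path => (A i0).2) @^-1` [set 0]
        `&` (@path_length R n : path -> R) @^-1` [set 1].
    apply/seteqP; split => A /=; first by move=> [-> ->].
    by case: (A i0) => x y /= [[-> ->]].
  apply: closedI; [apply: closedI|]; apply: preimage_closed;
    try exact: closed_eq; move=> A _.
  - exact: continuous_vertex1.
  - exact: continuous_vertex2.
  - exact: continuous_path_length.
move=> A [A0 A1] j; have := dist2_le_length A j i00; rewrite A0 A1 => h.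
have h2 : ((A j).1) ^+ 2 + ((A j).2) ^+ 2 <= 1.
  have := dist2_sqr 0 (A j); rewrite /= !sub0r !sqrrN => <-.
  by rewrite expr_le1// dist2_ge0.
by split; rewrite /I /= in_itv /= -ler_norml -(@ler_pXn2r _ 2)// ?nnegrE// expr1n
  real_normK ?num_real//; have := sqr_ge0 (A j).1; have := sqr_ge0 (A j).2; lra.
Qed.

(** The constraint [C] is the whole space in [quad_minimizer], and the set of paths with some small
    corner in [deficit_gap]. *)
Lemma unit_path_minimizer (i0 : 'I_n) (C : set path) (f : path -> R) :
  val i0 = 0 -> closed C -> continuous f ->
  (exists A : path, [/\ C A, A i0 = 0 & path_length A = 1]) ->
  exists P : path, [/\ C P, path_length P = 1 &
    forall A : path, C A -> A i0 = 0 -> path_length A = 1 -> f P <= f A].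
Proof.
move=> i00 cC cf [A [CA A0 A1]].
have cK : compact ([set A : path | A i0 = 0 /\ path_length A = 1] `&` C).
  by apply: compact_closedI; [exact: compact_unit_paths | exact: cC].
have [|P] := compact_EVT_min _ cK (continuous_subspaceT cf); first by exists A.
rewrite inE => -[[P0 P1] CP] Pmin; exists P; split => // B CB B0 B1.
by apply: Pmin; rewrite inE.
Qed.

End PathTopology.

(** * Stability for closed paths *)

Lemma dist2_scale (R : realType) (c : R) (p q : R * R) : 0 <= c ->
  dist2 (c *: p) (c *: q) = c * dist2 p q.
Proof.
move=> c0; apply/eqP; rewrite -(@eqrXn2 _ 2)// ?mulr_ge0 ?dist2_ge0//; apply/eqP.
by rewrite exprMn !dist2_sqr /= /GRing.scale /=; ring.
Qed.

Lemma dist2_eq0 (R : realType) (p q : R * R) : dist2 p q = 0 -> p = q.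
Proof.
move=> h; have := dist2_sqr p q; rewrite h expr0n /= => /esym/eqP.
rewrite paddr_eq0 ?sqr_ge0// !sqrf_eq0 !subr_eq0.
by case: p q h => [x y] [x' y'] _ /= /andP[/eqP -> /eqP ->].
Qed.

Section Stability.
Variables (R : realType) (n : nat).
Hypothesis n3 : (3 <= n)%N.
Implicit Types A P : 'I_n -> R * R.
Let t : R := tan (pi / n%:R).
Let i0 : 'I_n := Ordinal (leq_trans (isT : 0 < 3)%N n3).

Let nR : 0 < n%:R :> R. Proof. by rewrite ltr0n (leq_trans _ n3). Qed.
Let t0 : 0 < t. Proof. exact: tan_pi_div_gt0. Qed.

Definition path_deficit A : R := path_length A ^+ 2 - 4 * n%:R * t * shoelace A.

(** Translation invariant and homogeneous of degree 2. The case [quad (1 - b) (b * n%:R) (- (4 *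
    n%:R * t))] is [path_deficit] plus [b] times [n%:R * path_energy - path_length ^+ 2]. *)
Definition quad (a b c : R) A : R :=
  a * path_length A ^+ 2 + b * path_energy A + c * shoelace A.

Lemma path_energy_le A : path_energy A <= path_length A ^+ 2.
Proof.
rewrite expr2 {1}/path_length mulr_suml; apply: ler_sum => i _.
rewrite expr2 ler_wpM2l ?dist2_ge0//.
apply: le_trans (two_sides_le_length A i n3); by rewrite lerDl dist2_ge0.
Qed.

(** Such a path is constant. This settles the paths that cannot be rescaled to length 1. *)
Lemma quad_length0 a b c A : path_length A = 0 -> quad a b c A = 0.
Proof.
move=> L0; rewrite /quad L0 expr0n /= mulr0 add0r.
have E0 : path_energy A = 0.
  apply/eqP; rewrite eq_le path_energy_ge0 andbT.
  by rewrite (le_trans (path_energy_le A))// L0 expr0n.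
have e i : A i = A (ordS i).
  apply: dist2_eq0; apply/eqP; rewrite eq_le dist2_ge0 andbT -L0.
  by apply: le_trans (two_sides_le_length A i n3); rewrite lerDl dist2_ge0.
rewrite E0 /shoelace big1 ?mulr0 ?addr0// => i _.
by rewrite -e /cross mulrC subrr.
Qed.

Lemma quad_normalize a b c A : path_length A != 0 ->
  exists B : 'I_n -> R * R, [/\ B i0 = 0, path_length B = 1 &
    quad a b c A = path_length A ^+ 2 * quad a b c B].
Proof.
move=> L0; set L := path_length A in L0 *.
have Lp : 0 < L by rewrite lt0r L0 path_length_ge0.
exists (fun i => L^-1 *: (A i - A i0)).
have hL : path_length (fun i => L^-1 *: (A i - A i0)) = 1.
  rewrite -(mulVf L0) -[X in _ * X](path_length_shift A (A i0)) /path_length mulr_sumr.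
  by apply: eq_bigr => i _; rewrite dist2_scale// invr_ge0 ltW.
split => //; first by rewrite subrr scaler0.
rewrite /quad hL -/L.
have -> : path_energy (fun i => L^-1 *: (A i - A i0)) = L ^- 2 * path_energy A.
  rewrite -[X in _ = _ * X](path_energy_shift A (A i0)) /path_energy mulr_sumr.
  by apply: eq_bigr => i _; rewrite dist2_scale ?exprMn ?exprVn// invr_ge0 ltW.
have -> : shoelace (fun i => L^-1 *: (A i - A i0)) = L ^- 2 * shoelace A.
  rewrite -[X in _ = _ * X](shoelace_shift A (A i0)) /shoelace.
  rewrite [RHS]mulrCA [X in _ = _ * X]mulr_sumr.
  congr (_ * _); apply: eq_bigr => i _.
  by rewrite /cross /= /GRing.scale /=; field.
by field.
Qed.

Lemma continuous_quad a b c : continuous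
  (quad a b c : prod_topology (fun _ : 'I_n => (R * R)%type) -> R).
Proof.
move=> A; rewrite /quad.
have cL := @continuous_path_length R n.
have cS := @continuous_path_energy R n.
have cF := @continuous_shoelace R n.
pose T := prod_topology (fun _ : 'I_n => (R * R)%type).
have cc (k : R) (f : T -> R) : continuous f -> continuous (fun x => k * f x).
  move=> cf x; apply: (@continuousM _ _ (fun=> k) f); last exact: cf.
  exact: cst_continuous.
apply: (@continuousD _ _ _ (fun A : T => a * path_length A ^+ 2 + b * path_energy A)
  (fun A : T => c * shoelace A)); last exact: cc.
apply: (@continuousD _ _ _ (fun A : T => a * path_length A ^+ 2)
  (fun A : T => b * path_energy A)); last exact: cc.
apply: cc => {}A.
by apply: (@continuousM _ _ (@path_length R n : T -> R)
  (@path_length R n : T -> R)); exact: cL.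
Qed.

Lemma quad_minimizer a b c : (exists A, quad a b c A < 0) ->
  exists P, [/\ path_length P = 1, quad a b c P < 0 &
    forall A, quad a b c P * path_length A ^+ 2 <= quad a b c A].
Proof.
move=> [A0 QA0].
have L0 A : quad a b c A < 0 -> path_length A != 0.
  by apply: contraTneq => /(quad_length0 a b c) ->; rewrite ltxx.
have [B0 [B00 B01 QB0]] := quad_normalize a b c (L0 _ QA0).
have [|P [_ P1 Pmin]] := unit_path_minimizer (erefl : val i0 = 0%N) closedT
   (@continuous_quad a b c); first by exists B0.
have QP : quad a b c P < 0.
  apply: le_lt_trans (Pmin _ I B00 B01) _.
  have L2 : 0 < path_length A0 ^+ 2.
    by rewrite exprn_gt0// lt0r (L0 _ QA0) path_length_ge0.
  by move: QA0; rewrite QB0 pmulr_rlt0.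
exists P; split => // A.
have [LA|LA] := eqVneq (path_length A) 0.
  by rewrite LA (quad_length0 _ _ _ LA) expr0n mulr0.
have [B [B1 B2 ->]] := quad_normalize a b c LA.
by rewrite mulrC ler_wpM2l ?sqr_ge0// Pmin.
Qed.

Lemma equilateral_side P (i : 'I_n) :
  (forall i : 'I_n, dist2 (P i) (P (ordS i))
    = dist2 (P (ordS i)) (P (ordS (ordS i)))) ->
  dist2 (P i) (P (ordS i)) = path_length P / n%:R.
Proof.
move=> H; have K j : dist2 (P j) (P (ordS j)) = dist2 (P i0) (P (ordS i0)).
  case: j => m; elim: m => [|m IH] mn.
    by congr (dist2 (P _) (P (ordS _))); apply: val_inj.
  rewrite -(IH (ltnW mn)) (H (Ordinal (ltnW mn))).
  by congr (dist2 (P _) (P (ordS _))); apply: val_inj; rewrite /= modn_small.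
rewrite /path_length (eq_bigr _ (fun j _ => K j)) sumr_const card_ord K.
by rewrite -[_ *+ n]mulr_natl mulrAC divff ?mul1r// gt_eqF.
Qed.

Lemma equilateral_energy P :
  (forall i : 'I_n, dist2 (P i) (P (ordS i))
    = dist2 (P (ordS i)) (P (ordS (ordS i)))) ->
  n%:R * path_energy P = path_length P ^+ 2.
Proof.
move=> H; rewrite /path_energy.
rewrite (eq_bigr (fun=> (path_length P / n%:R) ^+ 2)); last first.
  by move=> i _; rewrite equilateral_side.
rewrite sumr_const card_ord -[_ *+ n]mulr_natl.
by field; rewrite gt_eqF.
Qed.

Lemma turn_defect_center_le A :
  turn_defect t (fun i => A i - centroid A)
  <= 2 * (path_energy A - 4 * t * shoelace A).
Proof.
rewrite -(path_energy_shift A (centroid A)) -(shoelace_shift A (centroid A)).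
apply: (turn_defect_le n3); rewrite sumrB sumr_const card_ord /centroid.
by rewrite -scaler_nat scalerA divff ?scale1r ?subrr// gt_eqF.
Qed.

Lemma energy_deficit_ge0 A : 0 <= path_energy A - 4 * t * shoelace A.
Proof.
have := le_trans (turn_defect_ge0 _ _) (turn_defect_center_le A).
by rewrite pmulr_rge0.
Qed.

(* Symmetrizing a vertex keeps the area and, by the hypothesis on the corners,
   lowers the form, so a minimizer with negative value would be equilateral;
   but on equilateral paths [path_length ^+ 2 = n * path_energy], where the form
   is nonnegative. *)
Lemma quad_ge0 (b : R) :
  (forall P, path_length P = 1 ->
    quad (1 - b) (b * n%:R) (- (4 * n%:R * t)) P < 0 ->
    b <= 1 /\ forall i,
      0 < 4 * corner P i ^+ 2 * (1 - b) + b * n%:R) ->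
  forall A, 0 <= quad (1 - b) (b * n%:R) (- (4 * n%:R * t)) A.
Proof.
move=> H A; rewrite leNgt; apply/negP => QA.
have [|P [P1 QP Pmin]] := @quad_minimizer (1 - b) (b * n%:R) (- (4 * n%:R * t)).
  by exists A.
have [b1 Hc] := H P P1 QP.
have eq i : dist2 (P i) (P (ordS i)) = dist2 (P (ordS i)) (P (ordS (ordS i))).
  have [B [B1 B2 B3 B4]] := symmetrize_vertex i n3 P1.
  apply: B4; apply/eqP; rewrite eq_le B2 /= leNgt; apply/negP => BP.
  have := Pmin B; have := Hc i; move: B3 QP; rewrite /quad B1 P1.
  have := path_length_ge0 B.
  set m := (X in X < 0); set LB := path_length B; set X := corner P i.
  set SB := path_energy B in BP *; set SP := path_energy P in BP m *.
  move=> LB0 LBX m0 Xb; rewrite -/m.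
  have D0 : 0 < SP - SB by rewrite subr_gt0.
  have XD0 : 0 <= 4 * X ^+ 2 * (SP - SB).
    by apply: mulr_ge0 (ltW D0); apply: mulr_ge0 (sqr_ge0 _).
  have LB1 : LB <= 1 by lra.
  have h1 : LB ^+ 2 <= LB by rewrite expr2 ler_piMl.
  have h2 : 4 * X ^+ 2 * (SP - SB) <= 1 - LB ^+ 2 by lra.
  (* Minimality, tested on [B], reads [(1 - b - m) * (1 - LB ^+ 2) + b * n * (SP - SB) <= 0]. As
     [1 - b - m] is nonnegative, [h2] bounds the first product below, and the corner hypothesis
     makes the sum positive. *)
  have h3 : (1 - b - m) * (4 * X ^+ 2 * (SP - SB)) <= (1 - b - m) * (1 - LB ^+ 2).
    by apply: ler_wpM2l => //; lra.
  have h4 : 0 <= - m * (4 * X ^+ 2 * (SP - SB)).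
    by apply: mulr_ge0 XD0; rewrite oppr_ge0 ltW.
  have h5 : 0 < (4 * X ^+ 2 * (1 - b) + b * n%:R) * (SP - SB) by rewrite mulr_gt0.
  have : m = 1 - b + b * n%:R * SP + - (4 * n%:R * t) * shoelace P.
    by rewrite /m expr1n mulr1.
  by lra.
have := equilateral_energy eq; rewrite P1 expr1n => eE.
have beE : b * (n%:R * path_energy P) = b by rewrite eE mulr1.
move: QP; rewrite /quad P1 expr1n => QP.
have := mulr_ge0 (ltW nR) (energy_deficit_ge0 P); lra.
Qed.

(** For [0 < b <= 1] the corner hypothesis of [quad_ge0] holds whatever the corners are, thanks to
    the term [b * n]. Here [b] is so small that the perturbation cancels at most half of a negative
    deficit. *)
Lemma path_deficit_ge0 A : 0 <= path_deficit A.
Proof.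
rewrite leNgt; apply/negP => D0.
set K := `|n%:R * path_energy A - path_length A ^+ 2| + 1.
have K0 : 0 < K by rewrite ltr_wpDl.
pose b := Num.min 1 (- path_deficit A / (2 * K)).
have b0 : 0 < b by rewrite lt_min ltr01 /= divr_gt0 ?oppr_gt0// mulr_gt0.
have b1 : b <= 1 by rewrite ge_min lexx.
have : 0 <= quad (1 - b) (b * n%:R) (- (4 * n%:R * t)) A.
  apply: quad_ge0 => P _ _; split => // i.
  apply: ltr_wpDl; last exact: mulr_gt0.
  by apply: mulr_ge0; [apply: mulr_ge0 (sqr_ge0 _)|rewrite subr_ge0].
have -> : quad (1 - b) (b * n%:R) (- (4 * n%:R * t)) A
    = path_deficit A + b * (n%:R * path_energy A - path_length A ^+ 2).
  by rewrite /quad /path_deficit; ring.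
have h1 : b * (n%:R * path_energy A - path_length A ^+ 2) <= b * K.
  by rewrite ler_pM2l// /K (le_trans (ler_norm _))// lerDl.
have h2 : b * K <= - path_deficit A / (2 * K) * K by rewrite ler_pM2r// ge_min lexx orbT.
have h3 : - path_deficit A / (2 * K) * K = - path_deficit A / 2.
  by field; rewrite gt_eqF.
lra.
Qed.

(* Half the corner [sin (2 pi / n) / n ^ 2] of the regular n-gon of perimeter 1. *)
Let h : R := t / ((1 + t ^+ 2) * n%:R ^+ 2).

Let h0 : 0 < h.
Proof.
by apply: divr_gt0 => //; apply: mulr_gt0; [rewrite ltr_wpDr ?sqr_ge0|exact: exprn_gt0].
Qed.

(** A path of deficit 0 minimizes the deficit, so no vertex move improves it: pushing excludes most
    straight corners, and symmetrization makes the sides at the others equal. For an equilateral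
    path the deficit controls the turn defect, whose vanishing fixes every corner. *)
Lemma path_deficit_eq0_corner P (i : 'I_n) :
  path_length P = 1 -> path_deficit P = 0 -> corner P i = 2 * h.
Proof.
move=> P1 D0; have c0 : 0 < 4 * n%:R * t by apply: mulr_gt0 t0; apply: mulr_gt0.
have eq j : dist2 (P j) (P (ordS j)) = dist2 (P (ordS j)) (P (ordS (ordS j))).
  have [X0|X0] := eqVneq (corner P j) 0.
    (* If the neighbours coincide, the path goes back along the same segment and the two sides are
       trivially equal. *)
    have [ab|ab] := eqVneq (P j) (P (ordS (ordS j))); first by rewrite -ab dist2C.
    have [B] := push_straight_corner n3 c0 P1 X0 ab.
    by rewrite -!/(path_deficit _) D0 ltNge path_deficit_ge0.
  have [B [B1 B2 B3 B4]] := symmetrize_vertex j n3 P1.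
  apply: B4; apply/eqP; rewrite eq_le B2 /= leNgt; apply/negP => BP.
  have : 0 < 4 * corner P j ^+ 2 * (path_energy P - path_energy B).
    by apply: mulr_gt0; [rewrite mulr_gt0// lt0r sqr_ge0 sqrf_eq0 X0|rewrite subr_gt0].
  move=> /lt_le_trans/(_ B3); rewrite P1 subr_gt0 => LB.
  have := path_deficit_ge0 B; move: D0; rewrite /path_deficit B1 P1.
  have : path_length B ^+ 2 < 1 by rewrite expr_lt1// path_length_ge0.
  lra.
have eE := equilateral_energy eq; rewrite P1 in eE.
have E0 : path_energy P - 4 * t * shoelace P = 0.
  apply: (mulfI (lt0r_neq0 nR)); rewrite mulr0 mulrBr eE.
  by move: D0; rewrite /path_deficit P1; lra.
have Q0 : turn_defect t (fun i => P i - centroid P) = 0.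
  apply/eqP; rewrite eq_le turn_defect_ge0 andbT.
  by apply: le_trans (turn_defect_center_le P) _; rewrite E0 mulr0.
have := turn_defect_eq0 i Q0.
have -> : dist2 (P i - centroid P) (P (ordS i) - centroid P) = dist2 (P i) (P (ordS i)).
  by rewrite /dist2 /=; congr (Num.sqrt (_ ^+ 2 + _ ^+ 2)); ring.
rewrite (equilateral_side _ eq) P1.
have -> : cross (P (ordS i) - centroid P - (P i - centroid P))
    (P (ordS (ordS i)) - centroid P - (P (ordS i) - centroid P)) = corner P i.
  by rewrite /corner /cross /=; ring.
have tp : 1 + t ^+ 2 != 0 by rewrite gt_eqF// ltr_wpDr ?sqr_ge0.
move=> e; apply: (mulfI tp); rewrite e /h.
by field; rewrite tp gt_eqF.
Qed.

Lemma corner_shift A c (i : 'I_n) : corner (fun i => A i - c) i = corner A i.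
Proof. by rewrite /corner /cross /=; ring. Qed.

(** The paths with some corner at most [h] form a closed set, on which the deficit attains its
    minimum; a zero minimum would force all corners to be [2 * h]. If the set has no path of length
    1, any positive [e] will do. *)
Lemma deficit_gap : exists e, 0 < e /\ forall P,
  path_length P = 1 -> (exists i, corner P i <= h) -> e <= path_deficit P.
Proof.
pose T := prod_topology (fun _ : 'I_n => (R * R)%type).
pose C : set T := \bigcup_(i in [set: 'I_n]) [set A | corner A i <= h].
have cC : closed C.
  apply: closed_bigcup => [|i _]; first exact: finite_finset.
  apply: (@preimage_closed _ _ ((fun A => corner A i) : T -> R) [set x | x <= h]).
    by move=> A _; exact: continuous_corner.
  exact: closed_le.
have sh P i : path_length P = 1 -> corner P i <= h ->
    [/\ C (fun j => P j - P i0), (fun j => P j - P i0) i0 = 0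
      & path_length (fun j => P j - P i0) = 1].
  move=> P1 Pi; rewrite path_length_shift subrr; split => //.
  by exists i => //=; rewrite corner_shift.
have [[A HA]|nA] := pselect (exists A : T, [/\ C A, A i0 = 0 & path_length A = 1]).
  have cD : continuous (path_deficit : T -> R).
    have -> : (path_deficit : T -> R) = quad 1 0 (- (4 * n%:R * t)).
      by apply/funext => B; rewrite /path_deficit /quad; ring.
    exact: continuous_quad.
  have [|P [[i _ /= Pi] P1 Pmin]] := unit_path_minimizer (erefl : val i0 = 0%N) cC cD.
    by exists A.
  exists (path_deficit P); split.
    rewrite lt0r path_deficit_ge0 andbT; apply/eqP => D0.
    by move: Pi; rewrite (path_deficit_eq0_corner _ P1 D0); have := h0; lra.
  move=> B B1 [j Bj]; have [s1 s2 s3] := sh B j B1 Bj.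
  have := Pmin _ s1 s2 s3.
  by rewrite {2}/path_deficit path_length_shift shoelace_shift.
exists 1; split => // P P1 [i Pi]; exfalso; apply: nA.
by exists (fun j => P j - P i0); exact: (sh P i).
Qed.

Lemma path_stability : exists c, 0 < c /\ forall A,
  c * (n%:R * path_energy A - path_length A ^+ 2) <= path_deficit A.
Proof.
have [e [e0 He]] := deficit_gap.
(* The first bound keeps the form positive on unit paths with a corner at most [h], by [deficit_gap]
   and energy at most 1. The second gives [4 * h ^+ 2 - c * n > 0], the corner hypothesis of
   [quad_ge0] on the other paths. *)
pose c := Num.min (e / n%:R) (2 * h ^+ 2 / n%:R).
have hh : 0 < 2 * h ^+ 2 / n%:R by rewrite divr_gt0// mulr_gt0// exprn_gt0.
have c0 : 0 < c by rewrite lt_min hh andbT divr_gt0.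
have c1 : c * n%:R <= e by rewrite -ler_pdivlMr// ge_min lexx.
have c2 : c * n%:R <= 2 * h ^+ 2 by rewrite -ler_pdivlMr// ge_min lexx orbT.
exists c; split => // A.
have key B : quad (1 - - c) (- c * n%:R) (- (4 * n%:R * t)) B
    = path_deficit B - c * (n%:R * path_energy B - path_length B ^+ 2).
  by rewrite /quad /path_deficit; ring.
rewrite -subr_ge0 -key; apply: quad_ge0 => P P1; rewrite key P1 => QP.
split; [by rewrite (le_trans _ ler01)// oppr_le0 ltW|move=> i].
have [Xi|Xi] := leP (corner P i) h.
  have := He P P1 (ex_intro _ i Xi).
  have := path_energy_le P; rewrite P1 expr1n => S1.
  have : c * n%:R * path_energy P <= c * n%:R * 1 by rewrite ler_pM2l// mulr_gt0.
  by move: QP; rewrite expr1n; lra.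
have X2 : h ^+ 2 < corner P i ^+ 2 by rewrite ltr_pXn2r// nnegrE ltW// (lt_trans h0).
have : 0 <= c * corner P i ^+ 2 by rewrite mulr_ge0 ?sqr_ge0 ?ltW.
have := exprn_gt0 2 h0.
lra.
Qed.

End Stability.

(** * Area of a triangle *)

(** The integral of a nonnegative function is a supremum over the simple functions below it, and a
    larger function has more of them. *)
Lemma nonneg_integral_mono d (T : measurableType d) (R : realType)
    (mu : {measure set T -> \bar R}) (f g : T -> \bar R) :
  (forall x, (0 <= f x)%E) -> (forall x, (f x <= g x)%E) ->
  (\int[mu]_x f x <= \int[mu]_x g x)%E.
Proof.
move=> f0 fg; have g0 x : (0 <= g x)%E := le_trans (f0 x) (fg x).
rewrite !ge0_integralTE//; apply: le_ereal_sup => _ /= [h hf <-].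
by exists h => // x; exact: le_trans (hf x) (fg x).
Qed.

Lemma integral_affine (R : realType) (a b s c : R) : a <= b ->
  (\int[lebesgue_measure]_(x in `[a, b]) (s * (x - c))%:E
   = (s * ((b - c) ^+ 2 - (a - c) ^+ 2) / 2)%:E)%E.
Proof.
rewrite le_eqVlt => /predU1P[->|ab].
  by rewrite set_itv1 integral_set1 subrr mulr0 mul0r.
pose F (x : R) := s / 2 * (x - c) ^+ 2.
have dF (x : R) : is_derive x 1 F (s * (x - c)).
  apply: is_derive_eq; rewrite /GRing.scale /=; by field.
have cF : continuous F.
  by move=> x; apply: differentiable_continuous; apply/derivable1_diffP; case: (dF x).
rewrite (@continuous_FTC2 _ _ F)//.
- by rewrite -EFinB /F; congr (_%:E); field.
- apply: continuous_subspaceT => x.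
  apply: (@continuousM _ _ (fun=> s) (fun x => x - c)); first exact: cst_continuous.
  apply: (@continuousB _ _ _ id (fun=> c)); [exact: id|exact: cst_continuous].
- split.
  + by move=> x _; case: (dF x).
  + exact/cvg_at_right_filter/cF.
  + exact/cvg_at_left_filter/cF.
- by move=> x _; rewrite derive1E; exact: derive_val.
Qed.

Definition cvx_comb3 (R : realType) (u v w : R * R) : set (R * R) :=
  [set q | exists a b c : R, [/\ 0 <= a, 0 <= b, 0 <= c, a + b + c = 1
    & q = (a * u.1 + b * v.1 + c * w.1, a * u.2 + b * v.2 + c * w.2)]].

Lemma cvx_comb3_swap12 (R : realType) (u v w : R * R) :
  cvx_comb3 u v w = cvx_comb3 v u w.
Proof.
by apply/seteqP; split => q [a [b [c [a0 b0 c0 abc ->]]]]; exists b, a, c;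
  split => //; rewrite -?abc; try (congr (_, _)); ring.
Qed.

Lemma cvx_comb3_swap23 (R : realType) (u v w : R * R) :
  cvx_comb3 u v w = cvx_comb3 u w v.
Proof.
by apply/seteqP; split => q [a [b [c [a0 b0 c0 abc ->]]]]; exists a, c, b;
  split => //; rewrite -?abc; try (congr (_, _)); ring.
Qed.

(** A Cavalieri certificate that [T] has area at most [A]: each vertical section lies in an interval
    of length [g x]. Certificates add up over finite covers. *)
Definition section_bound (R : realType) (T : set (R * R)) (A : R) : Prop :=
  exists g : R -> R, [/\ measurable_fun setT g, forall x, 0 <= g x,
    (\int[lebesgue_measure]_x (g x)%:E = A%:E)%E &
    forall x, exists c : R, forall y, T (x, y) -> c <= y <= c + g x].

(** The section length is a tent: it rises linearly from 0 at [u.1] to [k] at [v.1] and falls back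
    to 0 at [w.1], with integral [k * (w.1 - u.1) / 2]. *)
Lemma triangle_section_sorted (R : realType) (u v w : R * R) :
  u.1 <= v.1 -> v.1 <= w.1 -> u.1 < w.1 ->
  section_bound (cvx_comb3 u v w) (`|cross (v - u) (w - u)| / 2).
Proof.
move=> uv vw uw; pose D := `|cross (v - u) (w - u)|.
have wu : 0 < w.1 - u.1 by rewrite subr_gt0.
pose k := D / (w.1 - u.1).
have k0 : 0 <= k by rewrite divr_ge0 ?normr_ge0// ltW.
have kD : k * (w.1 - u.1) = D by rewrite divfK// gt_eqF.
(* When [u.1 = v.1] or [v.1 = w.1], the inverse of 0 is 0 and the corresponding piece vanishes. At
   [v.1] both pieces may count, which is harmless for an upper bound. *)
pose f1 (x : R) := k / (v.1 - u.1) * (x - u.1).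
pose f2 (x : R) := - (k / (w.1 - v.1)) * (x - w.1).
pose I1 : set R := `[u.1, v.1]%classic; pose I2 : set R := `[v.1, w.1]%classic.
have vu0 : 0 <= v.1 - u.1 by rewrite subr_ge0.
have wv0 : 0 <= w.1 - v.1 by rewrite subr_ge0.
pose g1 x := f1 x * \1_I1 x; pose g2 x := f2 x * \1_I2 x.
have g1E x : u.1 <= x <= v.1 -> g1 x = f1 x.
  by move=> h; rewrite /g1 indicE mem_set ?mulr1// /I1 /= in_itv.
have g2E x : v.1 <= x <= w.1 -> g2 x = f2 x.
  by move=> h; rewrite /g2 indicE mem_set ?mulr1// /I2 /= in_itv.
have g10 x : 0 <= g1 x.
  rewrite /g1 indicE; case: (boolP (x \in I1)); rewrite ?mulr0// mulr1.
  rewrite inE /I1 /= in_itv /= => /andP[ux _].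
  by apply: mulr_ge0; [exact: divr_ge0|rewrite subr_ge0].
have g20 x : 0 <= g2 x.
  rewrite /g2 indicE; case: (boolP (x \in I2)); rewrite ?mulr0// mulr1.
  rewrite inE /I2 /= in_itv /= => /andP[_ xw].
  by rewrite /f2 mulNr -mulrN; apply: mulr_ge0; [exact: divr_ge0|rewrite opprB subr_ge0].
have mf (s c : R) (I : set R) : measurable I ->
    measurable_fun setT (fun x : R => s * (x - c) * \1_I x).
  move=> mI; apply: measurable_funM; last exact: measurable_indic.
  by apply: measurable_funM => //; exact: measurable_funB.
have m1 : measurable_fun setT g1 by apply: mf; exact: measurable_itv.
have m2 : measurable_fun setT g2 by apply: mf; exact: measurable_itv.
have restr (f : R -> R) (I : set R) :
    (\int[lebesgue_measure]_x (f x * \1_I x)%:E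
     = \int[lebesgue_measure]_(x in I) (f x)%:E)%E.
  rewrite [RHS]integral_mkcond; apply: eq_integral => x _.
  by rewrite patchE indicE; case: ifP => _; rewrite ?mulr1 ?mulr0.
exists (fun x => g1 x + g2 x); split.
- exact: measurable_funD.
- by move=> x; rewrite addr_ge0.
- under eq_integral do rewrite EFinD.
  rewrite ge0_integralD//; [|by move=> *; rewrite lee_fin|exact/measurable_EFinP
    |by move=> *; rewrite lee_fin|exact/measurable_EFinP].
  rewrite !restr !integral_affine// -EFinD -/D -kD; congr (_%:E).
  have e1 : k / (v.1 - u.1) * ((v.1 - u.1) ^+ 2 - (u.1 - u.1) ^+ 2) = k * (v.1 - u.1).
    have [->|h] := eqVneq (v.1 - u.1) 0; first by rewrite subrr !expr0n /= subr0 !mulr0.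
    by field.
  have e2 : - (k / (w.1 - v.1)) * ((w.1 - w.1) ^+ 2 - (v.1 - w.1) ^+ 2) = k * (w.1 - v.1).
    rewrite -[v.1 - w.1]opprB sqrrN.
    have [->|h] := eqVneq (w.1 - v.1) 0; first by rewrite subrr !expr0n /= subr0 !mulr0.
    by field.
  rewrite e1 e2; by field.
move=> x.
(* Here [l] is the height of the line [uw] at [x], and [z] the signed vertical offset of [v] from
   that line; a point with weight [b] at [v] lies [b * z] above it. *)
pose l := u.2 + (w.2 - u.2) * ((x - u.1) / (w.1 - u.1)).
pose z := cross (w - u) (v - u) / (w.1 - u.1).
have zk : `|z| = k.
  rewrite /z /k normrM normfV (gtr0_norm wu) /D; congr (_ / _).
  by rewrite -normrN; congr (`| _ |); rewrite /cross; ring.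
have rb a b c : 0 <= a -> 0 <= b -> 0 <= c -> a + b + c = 1 ->
    x = a * u.1 + b * v.1 + c * w.1 -> b * k <= g1 x + g2 x.
  move=> a0 b0 c0 abc xE.
  have aE : a = 1 - b - c by lra.
  have cE : c = 1 - b - a by lra.
  have bvu := mulr_ge0 b0 vu0; have cwu := mulr_ge0 c0 (ltW wu).
  have bwv := mulr_ge0 b0 wv0; have awu := mulr_ge0 a0 (ltW wu).
  have x1 : u.1 <= x by rewrite xE aE; lra.
  have x2 : x <= w.1 by rewrite xE cE; lra.
  have [x3|x3] := ltP x v.1.
    have vu : 0 < v.1 - u.1 by rewrite subr_gt0 (le_lt_trans x1).
    apply: (@le_trans _ _ (g1 x)); last by rewrite lerDl.
    have -> : g1 x = k * ((x - u.1) / (v.1 - u.1)).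
      by rewrite g1E ?x1 ?ltW// /f1; ring.
    by rewrite mulrC ler_wpM2l// ler_pdivlMr// xE aE; lra.
  have [x4|x4] := ltP v.1 w.1.
    have wv : 0 < w.1 - v.1 by rewrite subr_gt0.
    apply: (@le_trans _ _ (g2 x)); last by rewrite lerDr.
    have -> : g2 x = k * ((w.1 - x) / (w.1 - v.1)).
      by rewrite g2E ?x3// /f2; ring.
    by rewrite mulrC ler_wpM2l// ler_pdivlMr// xE cE; lra.
  have vu : 0 < v.1 - u.1 by lra.
  apply: (@le_trans _ _ (g1 x)); last by rewrite lerDl.
  have xv : x = v.1 by lra.
  rewrite g1E ?x1 ?xv//= /f1 divfK ?gt_eqF// ler_piMl//; lra.
exists (if 0 <= z then l else l - (g1 x + g2 x)) => y [a [b [c [a0 b0 c0 abc [xE yE]]]]].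
have br := rb a b c a0 b0 c0 abc xE.
have ylz : y - l = b * z.
  have a1 : a = 1 - b - c by lra.
  rewrite /l /z yE xE a1 /cross /=; field; exact/lt0r_neq0.
have [z0|z0] := leP 0 z.
  rewrite (ger0_norm z0) in zk; have := mulr_ge0 b0 z0; rewrite zk in ylz *.
  by move=> ?; apply/andP; split; lra.
rewrite (ltr0_norm z0) in zk; have := mulr_ge0 b0 k0; move: br; rewrite -zk.
by move=> ? ?; apply/andP; split; lra.
Qed.

Lemma triangle_section (R : realType) (u v w : R * R) :
  cross (v - u) (w - u) != 0 ->
  section_bound (cvx_comb3 u v w) (`|cross (v - u) (w - u)| / 2).
Proof.
have s12 (p q r : R * R) : `|cross (q - p) (r - p)| = `|cross (p - q) (r - q)|.
  by rewrite -normrN; congr (`| _ |); rewrite /cross /=; ring.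
have s23 (p q r : R * R) : `|cross (q - p) (r - p)| = `|cross (r - p) (q - p)|.
  by rewrite -normrN; congr (`| _ |); rewrite /cross /=; ring.
rewrite -normr_gt0.
wlog uv : u v w / u.1 <= v.1.
  move=> H h; have [uv|vu] := leP u.1 v.1; first exact: H.
  by rewrite s12 cvx_comb3_swap12; apply: H; [exact: ltW|rewrite s12].
wlog vw : u v w uv / v.1 <= w.1.
  move=> H h; have [vw|wv] := leP v.1 w.1; first exact: H.
  have [uw|wu] := leP u.1 w.1.
    by rewrite s23 cvx_comb3_swap23; apply: H => //; [exact: ltW|rewrite s23].
  rewrite s23 cvx_comb3_swap23 s12 cvx_comb3_swap12.
  by apply: H => //; [exact: ltW|rewrite s12 s23].
move=> h; apply: triangle_section_sorted => //.
rewrite lt_neqAle (le_trans uv vw) andbT; apply: contraTneq h => uw.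
have uvE : v.1 = u.1 by apply/eqP; rewrite eq_le uv uw vw.
by rewrite /cross /= uvE -uw !subrr !mul0r mulr0 subrr normr0 ltxx.
Qed.

(** * Convex regions *)

Lemma R2_hausdorff (R : realType) : hausdorff_space (R * R)%type.
Proof. exact: norm_hausdorff. Qed.

(** The product measure integrates the measures of the vertical sections, and each section is
    covered by the intervals of the certificates. *)
Lemma area_le (R : realType) (I : finType) (K : set (R * R))
    (T : I -> set (R * R)) (a : I -> R) :
  closed K -> K `<=` \bigcup_(i in setT) T i ->
  (forall i, section_bound (T i) (a i)) -> area K <= \sum_i a i.
Proof.
move=> cK KT /choice [g Hg].
have g0 i x : 0 <= g i x by have [] := Hg i.
rewrite /area.
(* The bound is proved in the extended reals first, where it also gives the finiteness needed to
   undo [fine]. *)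
suff H : ((@lebesgue_measure R \x @lebesgue_measure R) K <= (\sum_i a i)%:E)%E.
  have K0 : (0 <= (@lebesgue_measure R \x @lebesgue_measure R) K)%E.
    by apply: integral_ge0 => x _; exact: measure_ge0.
  rewrite -lee_fin fineK// ge0_fin_numE//.
  by apply: le_lt_trans H _; rewrite ltry.
rewrite /product_measure1.
apply: (@le_trans _ _ (\int[lebesgue_measure]_x (\sum_i (g i x)%:E))%E).
  apply: nonneg_integral_mono => x /=; first exact: measure_ge0.
  have /choice[c Hc] : forall i, exists c : R,
      forall y, T i (x, y) -> c <= y <= c + g i x.
    by move=> i; have [_ _ _] := Hg i; apply.
  pose J i : set R := `[c i, c i + g i x]%classic.
  have mJ i : measurable (J i) by exact: measurable_itv.
  have mK : measurable (xsection K x).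
    apply: closed_measurable; rewrite /xsection.
    have -> : [set y | (x, y) \in K] = (fun y : R => (x, y)) @^-1` K.
      by apply/seteqP; split => y /=; rewrite inE.
    apply: preimage_closed => // y _; 
    refine (@cvg_pair _ _ _ (nbhs y) (nbhs x) (nbhs y) _ _ _ (fun=> x) id _ _).
      exact: cvg_cst.
    exact: cvg_id.
  have KJ : xsection K x `<=` \bigcup_(i in setT) J i.
    move=> y; rewrite /xsection /= inE => /KT [i _ Ti].
    by exists i => //; rewrite /J /= in_itv /=; exact: Hc.
  have := @content_sub_fsum _ _ _ (@lebesgue_measure R) I setT _ J finite_finset
    (fun i _ => mJ i) mK KJ.
  move=> /le_trans; apply.
  rewrite (fsbigE (index_enum I))//=; last 2 first.
    exact: index_enum_uniq.
    by move=> i _; rewrite mem_index_enum.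
  rewrite big_mkcond /=; apply: lee_sum => i _.
  have -> : i \in setT by rewrite inE.
  rewrite /J lebesgue_measure_itv /=.
  by case: ifP => _; rewrite -?EFinB lee_fin// addrAC subrr add0r.
rewrite ge0_integral_sum//; last 2 first.
  by move=> i; apply/measurable_EFinP; have [] := Hg i.
  by move=> i x _; rewrite lee_fin.
rewrite -sumEFin; apply: lee_sum => i _.
by have [_ _ -> _] := Hg i.
Qed.

Lemma ordS2_neq (n : nat) (i : 'I_n) : (3 <= n)%N -> ordS (ordS i) != i.
Proof.
move=> n3; rewrite -val_eqE /=; have := ltn_ord i.
rewrite leq_eqVlt => /predU1P[iE|i1]; first by rewrite iE modnn modn_small; lia.
move: i1; rewrite leq_eqVlt => /predU1P[iE|i2].
  by rewrite (@modn_small i.+1); last lia; rewrite iE modnn; lia.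
by rewrite !modn_small; lia.
Qed.

Section ConvexRegion.
Variables (R : realType) (K : set (R * R)) (p : R * R).
Hypotheses (Kcompact : compact K) (Kconvex : convex_set K).
Hypothesis pK : interior K p.

Lemma convex_region_comb (x y : R * R) (s : R) : K x -> K y -> 0 <= s <= 1 ->
  K ((1 - s) *: x + s *: y).
Proof.
move=> Kx Ky /andP[s0 s1].
have := Kconvex (Itv01 s0 s1) (mem_set Ky) (mem_set Kx).
by rewrite inE addrC.
Qed.

(** The homothety of centre [b] and ratio [1 - s], with inverse [phi], sends a neighbourhood of [p]
    in [K] to a neighbourhood of the given point, inside [K] by convexity. *)
Lemma interior_segment (b : R * R) (s : R) : K b -> 0 <= s < 1 ->
  interior K ((1 - s) *: p + s *: b).
Proof.
move=> Kb /andP[s0 s1]; have s1' : 1 - s != 0 by rewrite subr_eq0 gt_eqF.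
pose phi (z : R * R) := (1 - s)^-1 *: (z - s *: b).
have phic : continuous phi.
  move=> z; apply: cvgZl_tmp; apply: cvgB; [exact: cvg_id|exact: cvg_cst].
have phip : phi ((1 - s) *: p + s *: b) = p.
  by rewrite /phi addrK scalerA mulVf// scale1r.
have : nbhs ((1 - s) *: p + s *: b) (phi @^-1` K).
  by apply: phic; rewrite phip; exact: pK.
apply: filterS => z /= Kz.
have -> : z = (1 - s) *: phi z + s *: b.
  by rewrite /phi scalerA divff// scale1r subrK.
by apply: convex_region_comb => //; rewrite s0 ltW.
Qed.

(** Of two distinct points on one ray from [p], the nearer would be interior by
    [interior_segment]. *)
Lemma ray_boundary_unique (b1 b2 : R * R) (s : R) :
  (K `\` interior K) b1 -> (K `\` interior K) b2 -> 0 < s ->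
  b1 - p = s *: (b2 - p) -> b1 = b2.
Proof.
move=> [K1 I1] [K2 I2] s0 E.
have aux (b b' : R * R) (r : R) : K b' -> ~ interior K b -> 0 < r < 1 ->
    b - p = r *: (b' - p) -> False.
  move=> Kb' Ib /andP[r0 r1] bE; apply: Ib.
  have -> : b = (1 - r) *: p + r *: b'.
    by rewrite -[b](subrK p) bE scalerBr scalerBl scale1r addrC addrA addrAC.
  by apply: interior_segment => //; rewrite ltW.
have [s1|s1|s1] := ltgtP s 1.
- by exfalso; apply: (aux b1 b2 s) => //; rewrite s0.
- exfalso; apply: (aux b2 b1 s^-1) => //.
    by rewrite invr_gt0 s0 invf_lt1.
  by rewrite E scalerA mulVf ?scale1r// gt_eqF.
- by move: E; rewrite s1 scale1r => /(addIr (- p)).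
Qed.

(** The exit point maximizes the linear form [f] in the direction [d] over the compact slice of [K]
    by the line [h = 0]; at an interior point a small step along [d] would increase [f]. *)
Lemma ray_exit (q : R * R) : K q -> q != p ->
  exists (b : R * R) (s : R), [/\ (K `\` interior K) b, 0 <= s <= 1 &
    q = (1 - s) *: p + s *: b].
Proof.
move=> Kq qp; pose d := q - p.
pose f (z : R * R) := (z.1 - p.1) * d.1 + (z.2 - p.2) * d.2.
pose h (z : R * R) := (z.1 - p.1) * d.2 - (z.2 - p.2) * d.1.
have c1 : continuous (fun z : R * R => z.1 - p.1).
  by move=> z; apply: cvgB; [exact: cvg_fst|exact: cvg_cst].
have c2 : continuous (fun z : R * R => z.2 - p.2).
  by move=> z; apply: cvgB; [exact: cvg_snd|exact: cvg_cst].
have fc : continuous f.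
  by move=> z; apply: cvgD; apply: cvgM; first [exact: c1|exact: c2|exact: cvg_cst].
have hc : continuous h.
  by move=> z; apply: cvgB; apply: cvgM; first [exact: c1|exact: c2|exact: cvg_cst].
have cL : compact (K `&` h @^-1` [set 0]).
  apply: compact_closedI => //.
  by apply: preimage_closed; [move=> z _; exact: hc|exact: closed_eq].
have dd0 : 0 < d.1 ^+ 2 + d.2 ^+ 2.
  rewrite lt0r addr_ge0 ?sqr_ge0// andbT; apply: contraNneq qp => /eqP.
  rewrite paddr_eq0 ?sqr_ge0// !sqrf_eq0 /d /= !subr_eq0.
  by case: (q) (p) => [x y] [x' y'] /= /andP[/eqP -> /eqP ->].
have [|b] := compact_EVT_max _ cL (continuous_subspaceT fc).
  by exists q; split => //=; rewrite /h /d /=; ring.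
rewrite inE => -[Kb /= hb] bmax.
have fq : f q = d.1 ^+ 2 + d.2 ^+ 2 by rewrite /f /d /=; ring.
have fqb : f q <= f b by apply: bmax; rewrite inE; split => //=; rewrite /h /d /=; ring.
have fb0 : 0 < f b by rewrite (lt_le_trans _ fqb)// fq.
have bE : d = (f q / f b) *: (b - p).
  move: hb fb0; rewrite fq /h /f => hb fb0; rewrite [LHS]surjective_pairing.
  have e1 : (b.1 - p.1) * (d.1 ^+ 2 + d.2 ^+ 2)
      = d.1 * ((b.1 - p.1) * d.1 + (b.2 - p.2) * d.2)
        + d.2 * ((b.1 - p.1) * d.2 - (b.2 - p.2) * d.1) by ring.
  have e2 : (b.2 - p.2) * (d.1 ^+ 2 + d.2 ^+ 2)
      = d.2 * ((b.1 - p.1) * d.1 + (b.2 - p.2) * d.2)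
        - d.1 * ((b.1 - p.1) * d.2 - (b.2 - p.2) * d.1) by ring.
  rewrite hb !mulr0 ?addr0 ?subr0 in e1 e2.
  rewrite {1}/GRing.scale /=; congr (_, _); rewrite /GRing.scale /=.
    by rewrite mulrAC [_ * (b.1 - _)]mulrC e1 mulfK// gt_eqF.
  by rewrite mulrAC [_ * (b.2 - _)]mulrC e2 mulfK// gt_eqF.
exists b, (f q / f b); split.
- split => // Ib.
  have psi : continuous (fun e : R => b + e *: d).
    by move=> e; apply: cvgD; [exact: cvg_cst|apply: cvgZr_tmp; exact: cvg_id].
  have nb : nbhs (0 : R) ((fun e : R => b + e *: d) @^-1` K).
    by apply: psi; rewrite scale0r addr0.
  have [e /= [e0 Ke]] : exists e : R, 0 < e /\ K (b + e *: d).
    move/nbhs_ballP: nb => [r /= r0 rK]; exists (r / 2); split; first exact: divr_gt0.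
    apply: rK; rewrite /ball /= sub0r normrN gtr0_norm ?divr_gt0//.
    by rewrite ltr_pdivrMr// ltr_pMr// ltr1n.
  have := bmax (b + e *: d); rewrite inE => /(_ _)/wrap[].
    split => //=; rewrite -[RHS]hb /h /d /= /GRing.scale /=; ring.
  have -> : f (b + e *: d) = f b + e * (d.1 ^+ 2 + d.2 ^+ 2).
    by rewrite /f /d /= /GRing.scale /=; ring.
  by rewrite gerDl leNgt mulr_gt0.
- rewrite divr_ge0 ?(ltW fb0) ?fq ?(ltW dd0)//=.
  by rewrite ler_pdivrMr// mul1r -fq.
- by rewrite -[LHS](subrK p) -/d bE scalerBr scalerBl scale1r addrC addrA addrAC.
Qed.

End ConvexRegion.

(** * Convex polygons *)

Section Polygon.
Variables (R : realType) (n : nat) (P : convex_ngon R n).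
Hypothesis n3 : (3 <= n)%N.
Let A := vertex P.
Let K := region P.
Let i0 : 'I_n := Ordinal (leq_trans (isT : 0 < 3)%N n3).

Let Kclosed : closed K.
Proof. by apply: compact_closed; [exact: R2_hausdorff|exact: region_compact]. Qed.

Let boundaryE : closed_polygon A = K `\` interior K.
Proof. by rewrite (ngon_boundary P) -(closure_id _).1. Qed.

Let boundary_side (i : 'I_n) (t : R) : 0 <= t <= 1 ->
  (K `\` interior K) (side_point A i t).
Proof. by move=> t01; rewrite -boundaryE; exists i, t. Qed.

Let side_point0 (i : 'I_n) : side_point A i 0 = A i.
Proof. by rewrite /side_point subr0 scale1r scale0r addr0. Qed.

Let side_point_sub (i : 'I_n) (s : R) (p : R * R) : side_point A i s - p
  = (1 - s) *: (A i - p) + s *: (A (ordS i) - p).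
Proof.
by rewrite /side_point !scalerBr addrACA -opprD -scalerDl subrK scale1r.
Qed.

Let boundary_vertex (i : 'I_n) : (K `\` interior K) (A i).
Proof. by rewrite -side_point0; apply: boundary_side; rewrite lexx ler01. Qed.

Section Star.
Variable p : R * R.
Hypothesis pK : interior K p.

(** Twice the signed area of the triangle with apex [p] over the side [i]. *)
Definition fan (i : 'I_n) : R := cross (A i - p) (A (ordS i) - p).

Let ray_eq (i j : 'I_n) (s t l : R) : 0 <= s < 1 -> 0 <= t < 1 -> 0 < l ->
  side_point A i s - p = l *: (side_point A j t - p) -> i = j /\ s = t.
Proof.
move=> hs ht l0 E; apply: (@ngon_simple _ _ P i j s t hs ht).
have w (r : R) : 0 <= r < 1 -> 0 <= r <= 1.
  by move=> /andP[-> /ltW].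
refine (ray_boundary_unique (@region_convex _ _ P) pK (boundary_side i (w _ hs))
  (boundary_side j (w _ ht)) l0 E).
Qed.

(** Otherwise [p] is collinear with the side: either both endpoints lie on one ray from [p], against
    [ray_eq], or the side passes through the interior point [p]. *)
Lemma fan_neq0 (i : 'I_n) : fan i != 0.
Proof.
apply/eqP => c0; pose u := A i - p; pose v := A (ordS i) - p.
pose uu := u.1 ^+ 2 + u.2 ^+ 2; pose uv := u.1 * v.1 + u.2 * v.2.
have uu0 : 0 < uu.
  rewrite lt0r addr_ge0 ?sqr_ge0// andbT; apply/eqP => /eqP.
  rewrite paddr_eq0 ?sqr_ge0// !sqrf_eq0 /u /= !subr_eq0 => /andP[/eqP e1 /eqP e2].
  have [_ /=] := boundary_vertex i; apply; suff -> : A i = p by [].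
  by move: e1 e2; case: (A i) (p) => [x y] [x' y'] /= -> ->.
have cu : u.1 * v.2 - u.2 * v.1 = 0 := c0.
have vE : v = (uv / uu) *: u.
  have e1 : v.1 * uu = uv * u.1 - u.2 * (u.1 * v.2 - u.2 * v.1) by rewrite /uu /uv; ring.
  have e2 : v.2 * uu = uv * u.2 + u.1 * (u.1 * v.2 - u.2 * v.1) by rewrite /uu /uv; ring.
  rewrite cu !mulr0 ?addr0 ?subr0 in e1 e2.
  rewrite [LHS]surjective_pairing {1}/GRing.scale /=.
  congr (_, _); rewrite /GRing.scale /= mulrAC.
    by rewrite -e1 mulfK// gt_eqF.
  by rewrite -e2 mulfK// gt_eqF.
have [l0|l0] := ltP 0 (uv / uu).
  have [||||iS _] := @ray_eq (ordS i) i 0 0 (uv / uu); rewrite ?lexx ?ltr01//.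
    by rewrite !side_point0; exact: vE.
  by have := ordS_neq n3 i; rewrite iS eqxx.
pose s := (1 - uv / uu)^-1.
have l1 : 0 < 1 - uv / uu by lra.
have s01 : 0 <= s <= 1 by rewrite invr_ge0 ltW//= invf_le1//; lra.
have [_ /=] := boundary_side i s01; apply.
suff -> : side_point A i s = p by [].
apply: subr0_eq; rewrite side_point_sub -/u -/v vE scalerA -scalerDl.
have -> : 1 - s + s * (uv / uu) = 0.
  have -> : 1 - s + s * (uv / uu) = 1 - s * (1 - uv / uu) by ring.
  by rewrite /s mulVf ?subrr// gt_eqF.
by rewrite scale0r.
Qed.

(** If the signs differ, Cramer's rule gives [c = m *: b + k *: a] with [k > 0]. For [m >= 0] the
    ray from [p] to the third vertex meets the first side, and for [m < 0] the ray to the first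
    vertex meets the second side; both contradict [ray_eq]. *)
Lemma fan_same_sign (i : 'I_n) : 0 < fan i * fan (ordS i).
Proof.
rewrite ltNge; apply/negP => XY.
have X0 := fan_neq0 i; have Y0 := fan_neq0 (ordS i).
have k0 : 0 < - fan (ordS i) / fan i.
  rewrite mulNr oppr_gt0 lt_neqAle mulf_neq0 ?invr_eq0//=.
  have -> : fan (ordS i) / fan i = (fan i * fan (ordS i)) / fan i ^+ 2.
    by field.
  by rewrite pmulr_lle0// invr_gt0 exprn_even_gt0.
pose k := - fan (ordS i) / fan i.
pose a := A i - p; pose b := A (ordS i) - p; pose c := A (ordS (ordS i)) - p.
pose m := - cross c a / fan i.
have mX : m * fan i = - cross c a by rewrite divfK.
have kX : k * fan i = - fan (ordS i) by rewrite divfK.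
have cE : c = m *: b + k *: a.
  have e (x y z : R) : y * (m * fan i) + x * (k * fan i) = z * fan i ->
      z = m * y + k * x.
    by move=> xyz; apply: (mulIf X0); rewrite -xyz; ring.
  by rewrite [LHS]surjective_pairing; congr (_, _); apply: e; rewrite mX kX
    /fan -/a -/b -/c /cross; ring.
have [m0|m0] := leP 0 m.
  have mk : 0 < m + k by rewrite ltr_wpDl.
  have [||||iS _] := @ray_eq i (ordS (ordS i)) (m / (m + k)) 0 (m + k)^-1.
  - by rewrite divr_ge0 ?(ltW mk)//= ltr_pdivrMr// mul1r ltrDl.
  - by rewrite lexx ltr01.
  - by rewrite invr_gt0.
  - rewrite side_point0 side_point_sub -/a -/b -/c cE.
    move: (a) (b) => u v; rewrite scalerDr !scalerA addrC.
    congr (_ *: _ + _ *: _); field; exact: lt0r_neq0.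
  by have := ordS2_neq i n3; rewrite -iS eqxx.
have mk : 0 < 1 - m by lra.
have [||||iS _] := @ray_eq (ordS i) i (1 / (1 - m)) 0 (k / (1 - m)).
- by rewrite divr_ge0 ?(ltW mk)//= ltr_pdivrMr// mul1r; lra.
- by rewrite lexx ltr01.
- by rewrite divr_gt0.
- rewrite side_point0 side_point_sub -/a -/b -/c cE.
    move: (a) (b) => u v; rewrite scalerDr !scalerA addrA -scalerDl.
  have -> : 1 - 1 / (1 - m) + 1 / (1 - m) * m = 0 by field; exact: lt0r_neq0.
  by rewrite scale0r add0r div1r mulrC.
by have := ordS_neq n3 i; rewrite iS eqxx.
Qed.

Lemma sum_norm_fan : \sum_(i < n) `|fan i| = `|\sum_(i < n) fan i|.
Proof.
have sg (i : 'I_n) : 0 < fan i0 * fan i.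
  case: i => m; elim: m => [|m IH] mn.
    have -> : Ordinal mn = i0 by apply: val_inj.
    by rewrite -expr2 exprn_even_gt0//= fan_neq0.
  have := fan_same_sign (Ordinal (ltnW mn)).
  have -> : ordS (Ordinal (ltnW mn)) = Ordinal mn.
    by apply: val_inj; rewrite /= modn_small.
  move=> h2; have := mulr_gt0 (IH (ltnW mn)) h2.
  set x := fan i0; set y := fan (Ordinal _); set z := fan _.
  have -> : x * y * (y * z) = y ^+ 2 * (x * z) by ring.
  by rewrite pmulr_rgt0// exprn_even_gt0//= fan_neq0.
have [f0|f0] := ltP 0 (fan i0).
  have fp i : 0 < fan i by rewrite -(pmulr_rgt0 _ f0).
  rewrite gtr0_norm; last first.
    by rewrite (bigD1 i0)//= ltr_pwDl// sumr_ge0// => j _; exact: ltW.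
  by apply: eq_bigr => i _; rewrite gtr0_norm.
have {}f0 : fan i0 < 0 by rewrite lt_neqAle fan_neq0.
have fp i : fan i < 0 by rewrite -(nmulr_rgt0 _ f0).
rewrite ler0_norm; last by rewrite sumr_le0// => j _; exact: ltW.
by rewrite -sumrN; apply: eq_bigr => i _; rewrite ltr0_norm.
Qed.

Lemma region_fan : K `<=` \bigcup_(i in setT) cvx_comb3 p (A i) (A (ordS i)).
Proof.
move=> q Kq; have [->|qp] := eqVneq q p.
  exists i0 => //; exists 1, 0, 0; split => //; first by ring.
  by rewrite [LHS]surjective_pairing; congr (_, _); ring.
have [b [s [bb /andP[s0 s1] qE]]] :=
  ray_exit (@region_compact _ _ P) Kq qp.
move: bb; rewrite -boundaryE => -[i [t [/andP[t0 t1] bE]]].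
exists i => //; exists (1 - s), (s * (1 - t)), (s * t).
split; rewrite ?mulr_ge0 ?subr_ge0//; first by ring.
rewrite qE bE [LHS]surjective_pairing /side_point /= /GRing.scale /=.
by congr (_, _); ring.
Qed.

End Star.

Lemma ngon_area_le : ngon_area P <= `|shoelace A|.
Proof.
have [p pK] := region_interior P.
have H (i : 'I_n) : section_bound (cvx_comb3 p (A i) (A (ordS i)))
      ((fun i => `|fan p i| / 2) i).
  exact: triangle_section (fan_neq0 pK i).
have /= := area_le Kclosed (@region_fan p) H; move/le_trans; apply.
rewrite -mulr_suml sum_norm_fan// -(shoelace_shift A p) /shoelace normrM.
by rewrite mulrC ger0_norm.
Qed.

End Polygon.

(** A reflection reverses the sign of [shoelace] and preserves distances. It is needed because the
    area is bounded by [|shoelace|], whereas [path_deficit] contains the signed value. *)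
Lemma oriented_path (R : realType) (n : nat) (A : 'I_n -> R * R) :
  exists B : 'I_n -> R * R, [/\ shoelace B = `|shoelace A|,
    forall i j, dist2 (B i) (B j) = dist2 (A i) (A j) &
    forall i, dist2 (centroid B) (B i) = dist2 (centroid A) (A i)].
Proof.
have [A0|A0] := leP 0 (shoelace A); first by exists A; rewrite ger0_norm.
pose B i := ((A i).1, - (A i).2).
have conj (p q : R * R) : dist2 (p.1, - p.2) (q.1, - q.2) = dist2 p q.
  by rewrite /dist2 /=; congr (Num.sqrt (_ + _)); ring.
exists B; split => [|i j|i]; last 2 first.
- exact: conj.
- rewrite -[RHS]conj; congr (dist2 _ _); rewrite /centroid.
  rewrite [LHS]surjective_pairing /= !(raddf_sum fst) !(raddf_sum snd) /=.
  by rewrite sumrN scalerN.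
rewrite ltr0_norm// /shoelace -mulrN -sumrN; congr (_ * _).
by apply: eq_bigr => i _; rewrite /cross /B /=; ring.
Qed.

Theorem corollary1p3 (R : realType) (n : nat) (hn : (3 <= n)%N) :
  exists C : R, 0 < C /\
    forall P : convex_ngon R n,
      var_sides P + var_radii P <= C * deficit P.

Proof.
have nR : 0 < n%:R :> R by rewrite ltr0n (leq_trans _ hn).
have nn0 := lt0r_neq0 nR.
have [c [c0 Hc]] := path_stability R hn.
pose s : R := (4 * n%:R * sin (pi / n%:R) ^+ 2)^-1.
have s0 : 0 <= s.
  by rewrite /s invr_ge0; apply: mulr_ge0 (sqr_ge0 _); rewrite mulr_ge0// ltW.
(* The coefficient [a] comes from the sides, where [path_stability] is divided by [n ^+ 2]. The
   coefficient [b] comes from [var_radii_le], with the energy deficit rewritten as a multiple of the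
   sum of [path_deficit] and [n * path_energy - path_length ^+ 2]. *)
pose a : R := (c * n%:R ^+ 2)^-1; pose b : R := 2 * s / n%:R.
have a0 : 0 < a by rewrite invr_gt0 mulr_gt0// exprn_gt0.
have b0 : 0 <= b by rewrite divr_ge0 ?mulr_ge0// ltW.
exists (a + b * (c^-1 + 1)); split.
  by rewrite ltr_wpDr// mulr_ge0// addr_ge0// invr_ge0 ltW.
move=> P; have [B [Bsh Bd Bc]] := oriented_path (vertex P).
have LB : perimeter P = path_length B by apply: eq_bigr => i _; rewrite Bd.
have SB : sum_sq_sides P = path_energy B by apply: eq_bigr => i _; rewrite Bd.
have dB : path_deficit B <= deficit P.
  rewrite /path_deficit /deficit LB lerD2l lerN2 ler_wpM2l//.
    by apply: mulr_ge0 (ltW (tan_pi_div_gt0 R hn)); rewrite mulr_ge0// ltW.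
  by rewrite Bsh ngon_area_le.
have sE : var_sides P = (n%:R * path_energy B - path_length B ^+ 2) / n%:R ^+ 2.
  by rewrite /var_sides LB SB; field.
have ns : n%:R * path_energy B - path_length B ^+ 2 <= c^-1 * path_deficit B.
  by rewrite ler_pdivlMl.
have vs : var_sides P <= a * path_deficit B.
  rewrite sE ler_pdivrMr ?exprn_gt0//; apply: le_trans ns _.
  rewrite le_eqVlt; apply/orP; left; apply/eqP; rewrite /a.
  by field; rewrite nn0 lt0r_neq0.
have vr : var_radii P <= b * (c^-1 + 1) * path_deficit B.
  have := var_radii_le B hn; rewrite -/s.
  under eq_bigr do rewrite Bc; under [X in _ - _ * X ^+ 2]eq_bigr do rewrite Bc.
  rewrite -/(var_radii P) => /le_trans; apply.
  have -> : s * (2 * (path_energy B - 4 * tan (pi / n%:R) * shoelace B))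
      = b * ((n%:R * path_energy B - path_length B ^+ 2) + path_deficit B).
    by rewrite /b /path_deficit; field.
  rewrite -mulrA ler_wpM2l// mulrDl mul1r lerD2r//.
rewrite mulrDl; apply: le_trans (lerD vs vr) _.
rewrite -!mulrDl ler_wpM2l//.
by rewrite ltW// ltr_wpDr// mulr_ge0// addr_ge0// invr_ge0 ltW.
Qed.
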